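(* Let $T$ be NIP with monster model $\mathbb{M}$. The map $([\mu], [\nu]) \in \widetilde{\mathcal{M}}_x \times \widetilde{\mathcal{M}}_y \mapsto [\mu \otimes \nu] \in \widetilde{\mathcal{M}}_{xy}$ is $\emptyset$-type-definable.
   Context: $\mathfrak{M}_x(\mathbb{M})$ is the set of global Keisler measures in $x$ (finitely additive probability measures on definable-with-parameters subsets of $\mathbb{M}^x$). In an NIP theory, $\mu$ is generically stable if for some small model $M$ it is definable over $M$ ($M$-invariant with $\mathrm{tp}(b/M)\mapsto\mu(\varphi(x,b))$ continuous on $S_y(M)$ for all $\varphi$) and finitely satisfiable in $M$ (every formula of positive measure is realized in $M$). For generically stable $\mu_x,\nu_y$, $\mu\otimes\nu$ is the generically stable measure in $xy$ given by $(\mu\otimes\nu)(\varphi(x,y))=\int_{S_y(M)}\mu(\varphi(x,b_q))\,d\tilde\nu(q)$, where $M$ is a small model over which $\mu$ is invariant and $\varphi$ is defined, $b_q\models q$, and $\tilde\nu$ is the regular Borel probability measure on $S_y(M)$ extending $\nu|_M$. Coding of generically stable measures. For $\bar{a}=(a_1,\dots,a_n)$, $\mathrm{Av}(\bar{a};\varphi(x,b)):=\frac1n|\{i:\models\varphi(a_i,b)\}|$. By NIP there are numbers $n_{\varphi,\varepsilon}$, for $\varphi(x,y)\in L$ and $\varepsilon>0$, so that every generically stable $\mu$ has an $\varepsilon$-approximation on $\varphi$ (i.e. $\bar{a}$ with $|\mathrm{Av}(\bar{a};\varphi(x,b))-\mu(\varphi(x,b))|\le\varepsilon$ for all $b$)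 of length exactly $n_{\varphi,\varepsilon}$; fix these. For each tuple of variables $x$, let $X_x$ be the $\emptyset$-type-definable set of tuples $\bar{a}=(\bar{a}_{\varphi,1/k}:\varphi(x,y)\in L,k\ge1)$, $\bar{a}_{\varphi,1/k}\in(\mathbb{M}^x)^{n_{\varphi,1/k}}$, such that (i) $|\mathrm{Av}(\bar{a}_{\varphi,1/k_1};\varphi(x,b))-\mathrm{Av}(\bar{a}_{\varphi,1/k_2};\varphi(x,b))|\le2/k$ for all $\varphi$, $k$, $k_1,k_2\ge k$ and $b$; and (ii) for all $\varphi_1,\varphi_2,k,b_1,b_2$ with $\varphi_1(x,b_1)\wedge\varphi_2(x,b_2)$ inconsistent, $\mathrm{Av}(\bar{a}_{\varphi_1\vee\varphi_2,1/k};\varphi_1(x,b_1)\vee\varphi_2(x,b_2))$ differs from $\mathrm{Av}(\bar{a}_{\varphi_1,1/k};\varphi_1(x,b_1))+\mathrm{Av}(\bar{a}_{\varphi_2,1/k};\varphi_2(x,b_2))$ by at most $3/k$. For $\bar{a}\in X_x$, $\mu_{\bar{a}}(\varphi(x,b)):=\lim_k\mathrm{Av}(\bar{a}_{\varphi,1/k};\varphi(x,b))$ is a generically stable measure. $E_x(\bar{a},\bar{a}')$ holds iff $|\mathrm{Av}(\bar{a}_{\varphi,1/k};\varphi(x,b))-\mathrm{Av}(\bar{a}'_{\varphi,1/k};\varphi(x,b))|\le4/k$ for all $\varphi,k,b$; on $X_x$ this is a type-definable equivalence relation, holding iff $\mu_{\bar{a}}=\mu_{\bar{a}'}$. $\widetilde{\mathcal{M}}_x:=X_x/E_x$,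 and for a generically stable $\mu$, $[\mu]\in\widetilde{\mathcal{M}}_x$ is the unique class $\bar{a}/E_x$ with $\mu_{\bar{a}}=\mu$; $\mu\mapsto[\mu]$ is a bijection between generically stable measures in $x$ and $\widetilde{\mathcal{M}}_x$. A map between hyperdefinable sets is $A$-type-definable if its graph, pulled back to representatives, is $A$-type-definable. *)

(* Defs.v *)
From HB Require Import structures.
From mathcomp Require Import all_boot all_order all_algebra.
From mathcomp Require Import all_classical all_reals all_analysis.
Import Order.TTheory GRing.Theory Num.Theory.
Import numFieldNormedType.Exports.
Set Implicit Arguments.
Unset Strict Implicit.
Unset Printing Implicit Defensive.
Local Open Scope classical_set_scope.
Local Open Scope ring_scope.

(** * First-order logic (one-sorted, with equality) *)

Record language := Language {
  fun_symbol : Type; fun_arity : fun_symbol -> nat;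
  rel_symbol : Type; rel_arity : rel_symbol -> nat }.

Inductive term (L : language) (V : Type) : Type :=
| tVar of V
| tFun (s : fun_symbol L) of ('I_(fun_arity s) -> term L V).

(* [formula L V]: formulas with free variables among [V]; in [fEx phi] the
   bound variable is [None : option V]. *)
Inductive formula (L : language) (V : Type) : Type :=
| fEq of term L V & term L V
| fRel (s : rel_symbol L) of ('I_(rel_arity s) -> term L V)
| fNot of formula L V
| fOr of formula L V & formula L V
| fEx of formula L (option V).

Fixpoint term_rename L (V W : Type) (h : V -> W) (t : term L V) : term L W :=
  match t with
  | tVar v => tVar L (h v)
  | tFun s u => tFun (fun i => term_rename h (u i))
  end.

Fixpoint rename L (V W : Type) (h : V -> W) (phi : formula L V) : formula L W :=
  match phi with
  | fEq t u => fEq (term_rename h t) (term_rename h u)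
  | fRel s u => fRel (fun i => term_rename h (u i))
  | fNot p => fNot (rename h p)
  | fOr p q => fOr (rename h p) (rename h q)
  | fEx p => fEx (rename (omap h) p)
  end.

(* The carrier being a [pointedType] only says that structures are nonempty. *)
Record structure (L : language) := Structure {
  carrier :> pointedType;
  fun_interp : forall s : fun_symbol L, ('I_(fun_arity s) -> carrier) -> carrier;
  rel_interp : forall s : rel_symbol L, ('I_(rel_arity s) -> carrier) -> Prop }.

Fixpoint eval L (M : structure L) (V : Type) (v : V -> M) (t : term L V) : M :=
  match t with
  | tVar x => v x
  | tFun s u => fun_interp (fun i => eval v (u i))
  end.

Fixpoint sat L (M : structure L) (V : Type) (phi : formula L V) : (V -> M) -> Prop :=
  match phi with
  | fEq t u => fun v => eval v t = eval v u
  | fRel s u => fun v => rel_interp (fun i => eval v (u i))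
  | fNot p => fun v => ~ sat p v
  | fOr p q => fun v => sat p v \/ sat q v
  | fEx p => fun v => exists a : M, sat p (oapp v a)
  end.

(* Concatenation of tuples: if [x : I -> M] and [y : J -> M] then [x +++ y] is
   the tuple [xy], indexed by the disjoint union. *)
Definition concat (U V W : Type) (v : V -> U) (w : W -> U) : V + W -> U :=
  fun z => match z with inl x => v x | inr y => w y end.
Notation "v +++ w" := (concat v w) (at level 50, left associativity).

Definition theory (L : language) := set (formula L void).

Definition models L (N : structure L) (T : theory L) : Prop :=
  forall s, T s -> sat s (of_void N).

Definition complete_theory L (T : theory L) : Prop :=
  forall s : formula L void,
    (forall N : structure L, models N T -> sat s (of_void N)) \/
    (forall N : structure L, models N T -> ~ sat s (of_void N)).

Definition has_IP L (N : structure L) (I J : finType)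
    (phi : formula L (I + J)%type) : Prop :=
  exists (a : nat -> I -> N) (b : set nat -> J -> N),
    forall i S, sat phi (a i +++ b S) <-> S i.

Definition NIP L (T : theory L) : Prop :=
  forall (I J : finType) (phi : formula L (I + J)%type) (N : structure L),
    models N T -> ~ has_IP N phi.

(** * Type spaces *)

Section Types.
Context {L : language} (M : structure L) (A : set M) (J : Type).

(* An [L(A)]-formula in the variables [J] is a formula whose free variables are
   those in [J] together with the elements of [A]. *)
Definition pformula := formula L (J + sig A)%type.

Definition psat (phi : pformula) (v : J -> M) : Prop :=
  sat phi (v +++ (@sval M A)).

Definition complete_type (p : set pformula) : Prop :=
  (forall (k : nat) (s : 'I_k -> pformula), (forall i, p (s i)) ->
     exists v, forall i, psat (s i) v) /\
  (forall phi, p phi \/ p (fNot phi)).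

Definition stone := {p : set pformula | complete_type p}.

Lemma complete_tp (b : J -> M) : complete_type [set phi | psat phi b].
Proof.
split=> [k s sp|phi]; first by exists b.
by have [?|?] := pselect (psat phi b); [left | right].
Qed.

Definition tp (b : J -> M) : stone := exist _ _ (complete_tp b).

Definition realizes (b : J -> M) (q : stone) : Prop :=
  forall phi, sval q phi -> psat phi b.

Definition clopen_of (phi : pformula) : set stone := [set q | sval q phi].

Definition realization (q : stone) : J -> M := get [set b | realizes b q].

HB.instance Definition _ := gen_eqMixin pformula.
HB.instance Definition _ := gen_choiceMixin pformula.
HB.instance Definition _ :=
  isPointed.Build pformula (fEx (fEq (tVar L None) (tVar L None))).

HB.instance Definition _ := gen_eqMixin stone.
HB.instance Definition _ := gen_choiceMixin stone.
HB.instance Definition _ := isPointed.Build stone (tp point).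

HB.instance Definition _ :=
  @isSubBaseTopological.Build stone pformula setT clopen_of.

Definition borel_stone := g_sigma_algebraType (@open stone).

Definition definable_over (D : set (J -> M)) : Prop :=
  exists phi : pformula, D = [set v | psat phi v].

Definition type_definable (D : set (J -> M)) : Prop :=
  exists Sigma : set pformula, D = [set v | forall phi, Sigma phi -> psat phi v].

End Types.

Definition definable L (M : structure L) (J : Type) (D : set (J -> M)) : Prop :=
  definable_over setT D.

Definition regular_measure {R : realType} L (M : structure L) (A : set M) (J : Type)
    (P : probability (borel_stone A J) R) : Prop :=
  forall B : set (stone A J), measurable (B : set (borel_stone A J)) ->
    P B = ereal_inf [set P U | U in [set U : set (stone A J) | open U /\ B `<=` U]] /\
    P B = ereal_sup [set P C | C in [set C : set (stone A J) | compact C /\ C `<=` B]].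

(** * Monster models *)

(* The type [K] stands for a cardinal; [small K A] means [|A| < |K|]. *)
Definition small (K U : Type) (A : set U) : Prop := ~~ ([set: K] #<= A)%card.

Definition automorphism L (M : structure L) (g : M -> M) : Prop :=
  [/\ bijective g,
      forall (s : fun_symbol L) u, g (fun_interp (s := s) u) = fun_interp (g \o u) &
      forall (s : rel_symbol L) u,
        rel_interp (s := s) u <-> rel_interp (s := s) (g \o u)].

Definition saturated (K : Type) L (M : structure L) : Prop :=
  forall (A : set M), small K A ->
  forall (J : finType) (q : stone A J), exists b, realizes b q.

Definition strongly_homogeneous (K : Type) L (M : structure L) : Prop :=
  forall (A : set M), small K A ->
  forall g : M -> M,
    (forall k (phi : formula L 'I_k) (v : 'I_k -> M), (forall i, A (v i)) ->
       (sat phi v <-> sat phi (g \o v))) ->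
  exists2 h : M -> M, automorphism h & {in A, h =1 g}.

Record monster (K : Type) L (T : theory L) (M : structure L) : Prop := Monster {
  monster_models : models M T;
  monster_uncountable : small K [set: nat];
  monster_funs : small K [set: fun_symbol L];
  monster_rels : small K [set: rel_symbol L];
  monster_saturated : saturated K M;
  monster_homogeneous : strongly_homogeneous K M }.

Definition elementary_embedding L (N M : structure L) (h : N -> M) : Prop :=
  forall k (phi : formula L 'I_k) (v : 'I_k -> N), sat phi v <-> sat phi (h \o v).

(* [A] is the universe of a small elementary substructure of [M]. *)
Definition small_model (K : Type) L (M : structure L) (A : set M) : Prop :=
  small K A /\
  exists (N : structure L) (h : N -> M), elementary_embedding h /\ range h = A.

(** * Keisler measures *)

Section Keisler.
Context {R : realType} (K : Type) {L : language} {M : structure L}.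

Definition inst (I : Type) m (phi : formula L (I + 'I_m)%type) (b : 'I_m -> M) :
  set (I -> M) := [set x | sat phi (x +++ b)].

(* A global measure is carried by a function on all subsets of [I -> M], of
   which only the values on definable sets are relevant. *)
Definition keisler_measure (I : Type) (mu : set (I -> M) -> R) : Prop :=
  [/\ forall D, definable D -> 0 <= mu D,
      mu setT = 1 &
      forall D1 D2, definable D1 -> definable D2 -> D1 `&` D2 = set0 ->
        mu (D1 `|` D2) = mu D1 + mu D2].

Definition invariant_over (I : Type) (A : set M) (mu : set (I -> M) -> R) : Prop :=
  forall m (phi : formula L (I + 'I_m)%type) (b b' : 'I_m -> M),
    tp A b = tp A b' -> mu (inst phi b) = mu (inst phi b').

(* For [mu] invariant over [A], the function [q |-> mu (phi (x, b_q))] does not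
   depend on the choice of the realization [b_q] of [q]. *)
Definition definable_measure_over (I : Type) (A : set M) (mu : set (I -> M) -> R) : Prop :=
  invariant_over A mu /\
  forall m (phi : formula L (I + 'I_m)%type),
    continuous (fun q : stone A 'I_m => mu (inst phi (realization q))).

Definition finitely_satisfiable_in (I : Type) (A : set M)
    (mu : set (I -> M) -> R) : Prop :=
  forall D, definable D -> 0 < mu D -> exists2 a, D a & forall i, A (a i).

Definition generically_stable (I : Type) (mu : set (I -> M) -> R) : Prop :=
  keisler_measure mu /\
  exists A : set M,
    [/\ small_model K A, definable_measure_over A mu & finitely_satisfiable_in A mu].

Definition regular_extension (J : Type) (A : set M) (nu : set (J -> M) -> R)
    (P : probability (borel_stone A J) R) : Prop :=
  regular_measure P /\
  forall psi : pformula A J,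
    P (clopen_of psi) = (nu [set b | psat psi b])%:E.

(* [tensor mu nu D] is the common value of the integrals of the measures of the
   fibres of [D] over all admissible small models (and [0] if there are none,
   which happens when [D] is not definable). *)
Definition tensor (I J : Type) (mu : set (I -> M) -> R) (nu : set (J -> M) -> R)
    (D : set (I + J -> M)) : R :=
  xget 0 [set r | exists (A : set M) (P : probability (borel_stone A J) R),
    [/\ small_model K A, invariant_over A mu, definable_over A D,
        regular_extension nu P &
        r%:E = (\int[P]_(q in [set: borel_stone A J])
                  (mu [set a | D (a +++ realization (q : stone A J))])%:E)%E]].

Definition Av (I : Type) N (a : 'I_N -> I -> M) (D : set (I -> M)) : R :=
  #|[pred i | `[< D (a i) >] ]|%:R / N%:R.

Definition is_approximation (I : Type) m (phi : formula L (I + 'I_m)%type) (eps : R)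
    (mu : set (I -> M) -> R) N (a : 'I_N -> I -> M) : Prop :=
  forall b, `|Av a (inst phi b) - mu (inst phi b)| <= eps.

Definition approximation_numbers
    (n : forall (I : finType) m, formula L (I + 'I_m)%type -> R -> nat) : Prop :=
  forall (I : finType) m (phi : formula L (I + 'I_m)%type) (eps : R), 0 < eps ->
    (0 < n I m phi eps)%N /\
    forall mu : set (I -> M) -> R, generically_stable mu ->
      exists a : 'I_(n I m phi eps) -> I -> M, is_approximation phi eps mu a.

End Keisler.

(** * Hyperdefinable sets *)

Section Hyperdefinable.
Context {L : language} {M : structure L}.

Definition eclass (V : Type) (X : set (V -> M)) (E : (V -> M) -> (V -> M) -> Prop)
  (a : V -> M) : set (V -> M) := [set a' | X a' /\ E a a'].

Definition quotient (V : Type) (X : set (V -> M)) (E : (V -> M) -> (V -> M) -> Prop) :=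
  {C : set (V -> M) | exists2 a, X a & C = eclass X E a}.

Definition map_type_definable (A : set M) (V1 V2 V3 : Type) X1 E1 X2 E2 X3 E3
    (f : @quotient V1 X1 E1 * @quotient V2 X2 E2 -> @quotient V3 X3 E3) : Prop :=
  type_definable A [set v : V1 + V2 + V3 -> M |
    exists C1 C2, [/\ sval C1 (v \o inl \o inl), sval C2 (v \o inl \o inr)
                    & sval (f (C1, C2)) (v \o inr)]].

End Hyperdefinable.

(** * Coding of generically stable measures *)

Section Coding.
Context {R : realType} {L : language} (M : structure L)
  (n : forall (I : finType) m, formula L (I + 'I_m)%type -> R -> nat).

(* Indices [k : nat] stand for the positive integers [k.+1], so that the blocks
   of a code are indexed by the formulas and the precisions [1 / k.+1]. *)
Definition prec (k : nat) : R := k.+1%:R^-1.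

Record code_index (I : finType) := CodeIndex {
  ci_arity : nat;
  ci_formula : formula L (I + 'I_ci_arity)%type;
  ci_prec : nat;
  ci_pos : 'I_(n ci_formula (prec ci_prec));
  ci_var : I }.

Definition block (I : finType) (a : code_index I -> M) m
    (phi : formula L (I + 'I_m)%type) (k : nat) : 'I_(n phi (prec k)) -> I -> M :=
  fun i x => a (CodeIndex i x).
Arguments block {I} a {m} phi k _ _.

(* The disjunction [phi1 (x, y1) \/ phi2 (x, y2)], as a formula in [x] and [y1 y2]. *)
Definition disj (I : Type) m1 m2 (phi1 : formula L (I + 'I_m1)%type)
    (phi2 : formula L (I + 'I_m2)%type) : formula L (I + 'I_(m1 + m2))%type :=
  fOr (rename (inl +++ (inr \o lshift m2)) phi1)
      (rename (inl +++ (inr \o @rshift m1 m2)) phi2).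

Definition code_set (I : finType) : set (code_index I -> M) := [set a |
  (forall m (phi : formula L (I + 'I_m)%type) k k1 k2 b,
     (k <= k1)%N -> (k <= k2)%N ->
     `|Av (block a phi k1) (inst phi b) - Av (block a phi k2) (inst phi b)|
       <= 2 * prec k) /\
  (forall m1 m2 (phi1 : formula L (I + 'I_m1)%type)
     (phi2 : formula L (I + 'I_m2)%type) k b1 b2,
     inst phi1 b1 `&` inst phi2 b2 = set0 :> set (I -> M) ->
     `|Av (block a (disj phi1 phi2) k) (inst phi1 b1 `|` inst phi2 b2)
       - (Av (block a phi1 k) (inst phi1 b1) + Av (block a phi2 k) (inst phi2 b2))|
       <= 3 * prec k)].

Definition code_equiv (I : finType) (a a' : code_index I -> M) : Prop :=
  forall m (phi : formula L (I + 'I_m)%type) k b,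
    `|Av (block a phi k) (inst phi b) - Av (block a' phi k) (inst phi b)|
      <= 4 * prec k.

(* [measure_of_code a mu] states that [mu_a = mu] as global measures. *)
Definition measure_of_code (I : finType) (a : code_index I -> M)
    (mu : set (I -> M) -> R) : Prop :=
  forall m (phi : formula L (I + 'I_m)%type) b,
    (fun k => Av (block a phi k) (inst phi b) : R) @ \oo --> mu (inst phi b).

Definition codes (I : finType) : Type := quotient (@code_set I) (@code_equiv I).

(* [is_code C mu] states that [C] is the class of the codes of [mu]. *)
Definition is_code (I : finType) (C : codes I) (mu : set (I -> M) -> R) : Prop :=
  exists2 a, code_set a & sval C = eclass (@code_set I) (@code_equiv I) a /\
                          measure_of_code a mu.

End Coding.

(* Main.v *)
Require Import Defs.
From HB Require Import structures.
From mathcomp Require Import finmap.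
From mathcomp Require Import all_boot all_order all_algebra.
From mathcomp Require Import all_classical all_reals all_analysis.
From mathcomp Require Import lra.
Import Order.TTheory GRing.Theory Num.Theory.
Import numFieldNormedType.Exports.
Set Implicit Arguments.
Unset Strict Implicit.
Unset Printing Implicit Defensive.
Local Open Scope classical_set_scope.
Local Open Scope ring_scope.

(** The graph of the map. Suppose that the tuple (a_i) approximates mu on
   phi(x; yz), uniformly in (y, z), and that (b_j) approximates nu on phi(y; xz),
   uniformly in (x, z). Integrating the first approximation against nu and then
   using the second one at each a_i shows that mu (x) nu gives to phi(xy, d) a value
   close to the average of phi(a_i b_j, d) over all pairs (i, j), uniformly in d
   ([tensor_Av]). Codes a of mu and b of nu contain such tuples for every formula and
   every precision 1/k. So a code c represents mu (x) nu if and only if, for all phi,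
   k and d, the average of phi(_, d) over the k-th tuple of c is within 6/k of its
   average over the pairs of entries of a and b ([product_codeP]). For given phi and
   k, this is one first-order condition without parameters on finitely many entries
   of a, b and c, and so are the conditions that define codes
   ([product_code_type_definable], [code_set_type_definable]).

   The value of the tensor product. It is an integral over the Stone space of a small
   model A over which mu is invariant and D is definable, whereas the entries of an
   approximating tuple of mu may lie outside A. The function b |-> mu(D_b) is a
   uniform limit of step functions, namely of the frequencies of D_b in the
   approximating tuples, which are definable over some small set. By saturation, its
   invariance over A makes it a uniform limit of A-definable step functions
   ([descent]). Hence its integral is a limit of finite sums, the finitely additive
   integral of the step functions against nu, and this limit depends neither on A nor
   on the Borel measure ([tensor_close]). There is at least one such integral, because
   nu has a regular Borel extension ([regular_extension_exists]) and small models
   exist ([small_model_containing]). The latter rests on the fact that there are fewer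
   formulas than elements of K, hence on the equality of an infinite cardinal with its
   square ([embeds_square]).

   The map is defined on all pairs of codes. A finitely additive measure that is
   uniformly approximated, on each formula, by tuples from one small model is
   generically stable over this model ([keisler_gs]). This applies to the measure of
   any code ([code_gs]) and to the tensor product of two generically stable measures
   ([tensor_gs]); conversely, a generically stable measure has a code ([gs_code]). *)

(** * Arithmetic of infinite cardinals *)

Definition embeds (A B : Type) := exists f : A -> B, injective f.

Lemma embeds_trans B A C : embeds A B -> embeds B C -> embeds A C.
Proof. by move=> [f fI] [g gI]; exists (g \o f) => x y /gI /fI. Qed.

Lemma smallE (K U : Type) (A : set U) : small K A <-> ~ embeds K (sig A).
Proof.
rewrite /small; split=> [/negP nKA [f fI]|nKA]; last first.
  apply/negP => /card_leP[f]; apply: nKA.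
  exists (fun k => exist A (val (f (SigSub (mem_set (I : [set: K] k)))))
                     (set_mem (valP (f (SigSub (mem_set (I : [set: K] k))))))).
  move=> x y /(congr1 sval) /= /val_inj.
  by move=> /(@inj _ _ _ f _ _ (mem_set I) (mem_set I)) /(congr1 val).
apply: nKA; have /injfunPex[g] : exists2 g : K -> U,
    set_fun [set: K] A g & set_inj [set: K] g.
  exists (fun k => sval (f k)); first by move=> k _; exact: svalP.
  move=> x y _ _ fxy; apply: fI; move: fxy.
  by case: (f x) (f y) => [u Au] [v Av] /= uv; subst v; congr exist.
exact: inj_card_le.
Qed.

Lemma embeds_setT U : embeds U (sig [set: U]).
Proof. by exists (fun u => exist _ u I) => x y /(congr1 sval). Qed.

(** By Zorn's lemma there is a maximal graph of a partial injection; it is total or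
   surjective, since otherwise a pair could be added. *)
Lemma embeds_total A B : embeds A B \/ embeds B A.
Proof.
pose P (G : set (A * B)) :=
  (forall a b b', G (a, b) -> G (a, b') -> b = b') /\
  (forall a a' b, G (a, b) -> G (a', b) -> a = a').
have [F FP totF|G [[Gf Gi] Gmax]] := @Zorn_bigcup _ P.
  split=> [a b b' [X FX Xab] [Y FY Yab]|a a' b [X FX Xab] [Y FY Yab]].
    by have [XY|YX] := totF _ _ FX FY; [apply: (FP _ FY).1|apply: (FP _ FX).1];
      eauto.
  by have [XY|YX] := totF _ _ FX FY;
     [apply: ((FP _ FY).2 _ _ b)|apply: ((FP _ FX).2 _ _ b)]; eauto.
have [domG|] := pselect (forall a, exists b, G (a, b)).
  left; have /choice[f fG] := domG; exists f => x y fxy.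
  by apply: (Gi _ _ (f x)) => //; rewrite fxy.
move=> /existsNP[a /forallNP aG]; right.
have [ranG|] := pselect (forall b, exists a, G (a, b)).
  have /choice[f fG] := ranG; exists f => x y fxy.
  by apply: (Gf (f x)) => //; rewrite fxy.
move=> /existsNP[b /forallNP bG]; exfalso.
apply: (Gmax (G `|` [set (a, b)])).
  split; first by move=> x Gx; left.
  by move=> sub; apply: (aG b); apply: sub; right.
split=> [x y y'|x x' y] [H|[Ex Ey]] [H'|[Ex' Ey']].
- exact: Gf H H'.
- by subst; case: (aG _ H).
- by subst; case: (aG _ H').
- by rewrite Ey.
- exact: Gi H H'.
- by subst; case: (bG _ H).
- by subst; case: (bG _ H').
- by rewrite Ex.
Qed.

(** Hessenberg's theorem, by Zorn's lemma on the injections [A * A -> A], where [A] is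
   a subset of [S] containing a fixed countable set. If [A] is maximal, then [A] does
   not embed into its complement: for a copy [B] of [A] in the complement, the part
   of the square of [A + B] outside that of [A] would embed into [B]. So the
   complement embeds into [A], and [S] embeds into [A * A].

   An injection is represented by its graph, from which [A] is recovered on the
   diagonal, by [fld]. The empty graph satisfies [P], as the union of the empty chain
   has to. *)
Section Square.
Variables (S : Type) (e : nat -> S) (eI : injective e).

Let fld (G : set ((S * S) * S)) (s : S) := exists t, G ((s, s), t).

Let P (G : set ((S * S) * S)) := [/\
  forall p t t', G (p, t) -> G (p, t') -> t = t',
  forall p p' t, G (p, t) -> G (p', t) -> p = p',
  forall p t, G (p, t) -> [/\ fld G p.1, fld G p.2 & fld G t],
  forall a b, fld G a -> fld G b -> exists t, G ((a, b), t) &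
  forall p t, G (p, t) -> forall i, fld G (e i)].

Let chainP (F : set (set ((S * S) * S))) : F `<=` P -> total_on F subset ->
  P (\bigcup_(X in F) X).
Proof.
move=> FP tot.
have fldS X Y s : X `<=` Y -> fld X s -> fld Y s by move=> XY [t /XY]; exists t.
have fldF X s : F X -> fld X s -> fld (\bigcup_(X in F) X) s.
  by move=> FX; apply: fldS; exact: bigcup_sup.
split.
- move=> p t t' [X FX Xp] [Y FY Yp].
  have [XY|YX] := tot _ _ FX FY.
    by have [H _ _ _ _] := FP _ FY; apply: H Yp; exact: XY.
  by have [H _ _ _ _] := FP _ FX; apply: H Xp _; exact: YX.
- move=> p t t' [X FX Xp] [Y FY Yp].
  have [XY|YX] := tot _ _ FX FY.
    by have [_ H _ _ _] := FP _ FY; apply: H Yp; exact: XY.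
  by have [_ H _ _ _] := FP _ FX; apply: H Xp _; exact: YX.
- move=> p t [X FX Xp]; have [_ _ H _ _] := FP _ FX; have [] := H _ _ Xp.
  by split; apply: fldF; eauto.
- move=> a b [t [X FX Xa]] [u [Y FY Yb]].
  have [XY|YX] := tot _ _ FX FY.
    have [_ _ _ H _] := FP _ FY.
    by have [||v Yv] := H a b; [exists t; exact: XY|exists u|exists v; exists Y].
  have [_ _ _ H _] := FP _ FX.
  by have [||v Xv] := H a b; [exists t|exists u; exact: YX|exists v; exists X].
- move=> p t [X FX Xp] i; have [_ _ _ _ H] := FP _ FX.
  by apply: fldF FX _; exact: H Xp i.
Qed.

Let base : set ((S * S) * S) :=
  [set z | exists i j, z = ((e i, e j), e (pickle (i, j)))].

Let baseP : P base.
Proof.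
have fldb i : fld base (e i) by exists (e (pickle (i, i))), i, i.
split.
- by move=> p t t' [i [j [-> ->]]] [i' [j' [/eI -> /eI -> ->]]].
- by move=> p p' t [i [j [-> ->]]] [i' [j' [-> /eI]]] /(pcan_inj pickleK)[-> ->].
- by move=> p t [i [j [-> ->]]]; split; exact: fldb.
- move=> a b [t [i [j [-> _ _]]]] [u [i' [j' [-> _ _]]]].
  by exists (e (pickle (i, i'))), i, i'.
- by move=> *.
Qed.

Lemma embeds_square : embeds (S * S) S.
Proof.
have [G [GP Gmax]] := Zorn_bigcup chainP.
have G0 : exists z, G z.
  apply: contrapT => /forallNP G0; apply: (Gmax base _ baseP).
  split; first by move=> z /G0.
  move=> /(_ ((e 0%N, e 0%N), e (pickle (0%N, 0%N)))) bG; apply: (G0 _ (bG _)).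
  by exists 0%N, 0%N.
have [Gf Gi Gfld Gtot Ge] := GP; case: G0 => -[p0 t0] /Ge{p0 t0} fe.
pose A := sig (fld G); pose B := sig [set s | ~ fld G s].
have sinj (Q : set S) (x y : sig Q) : sval x = sval y -> x = y.
  by case: x y => [x Qx] [y Qy] /= xy; subst y; congr exist.
have /choice[g gG] : forall x : A * A, exists t : A, G ((sval x.1, sval x.2), sval t).
  move=> [[a Aa] [b Ab]] /=; have [t Gt] := Gtot a b Aa Ab.
  by have [_ _ At] := Gfld _ _ Gt; exists (exist _ t At).
have gI : injective g.
  move=> [x1 x2] [y1 y2] /= gxy; have := gG (x1, x2); rewrite gxy => H.
  by have [/sinj -> /sinj ->] := Gi _ _ _ H (gG (y1, y2)).
have [c0 c1] : exists c : nat -> A, injective c.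
  by exists (fun i => exist _ (e i) (fe i)) => i j /(congr1 sval) /eI.
have [[h hI]|[h hI]] := embeds_total B A.
(* the complement of [A] embeds into [A]; two constants tell it from [A] in [A * A] *)
  have [k kI] : embeds S A.
    exists (fun s => match pselect (fld G s) with
              | left As => g (c0 0%N, exist _ s As)
              | right nAs => g (c0 1%N, h (exist _ s nAs)) end) => x y.
    by case: pselect => Ax; case: pselect => Ay /gI[];
      by [move=> -> | move=> /c1 | move=> /hI[]].
  exists (fun z => sval (g (k z.1, k z.2))) => -[x1 x2] [y1 y2] /= /sinj /gI[].
  by move=> /kI -> /kI ->.
(* [h] sends [A] to its complement: [G] extends to the union of [A] and [h A] *)
exfalso.
pose pt (b : bool) (x : A) := if b then sval (h x) else sval x.
have ptI b x b' x' : pt b x = pt b' x' -> b = b' /\ x = x'.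
  rewrite /pt; case: b b' => -[]; [by move=> /sinj /hI | | |by move=> /sinj].
    by case: (h x) => s /= nGs E; subst s; case: nGs; exact: svalP.
  by case: (h x') => s /= nGs E; subst s; case: nGs; exact: svalP.
have ptA b x : fld G (pt b x) -> b = false.
  by case: b => //=; case: (h x).
(* the number [b.*2 + b'] tells apart the four blocks of the square of [A + h A] *)
pose v (b b' : bool) x x' := h (g (c0 (b.*2 + b')%N, g (x, x'))).
have vI b b' x x' d d' y y' : v b b' x x' = v d d' y y' ->
    [/\ b = d, b' = d', x = y & x' = y'].
  move=> /hI /gI[/c1 bd /gI[-> ->]].
  by case: b b' d d' bd => -[] [] [].
pose G' : set ((S * S) * S) := G `|`
  [set z | exists b b' x x', b || b' /\
     z = ((pt b x, pt b' x'), sval (v b b' x x'))].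
have fld' s : fld G' s <-> exists b x, s = pt b x.
  split=> [[t [Gs|[b [_ [x [_ [_ [-> _ _]]]]]]]]|[[] [x ->]]]; last 2 first.
  - by exists (sval (v true true x x)); right; exists true, true, x, x.
  - by have [t Gt] := svalP x; exists t; left.
  - by exists false, (exist _ s (ex_intro _ t Gs)).
  - by exists b, x.
have fldG s : fld G s -> fld G' s by move=> Gs; apply/fld'; exists false, (exist _ s Gs).
have G'G z : G' z -> (G z /\ fld G z.2) \/ ~ fld G z.2 /\ exists b b' x x', b || b' /\
     z = ((pt b x, pt b' x'), sval (v b b' x x')).
  move=> [Gz|H]; first by left; split=> //; case: z Gz => p t /Gfld[].
  right; split=> //; case: H => b [b' [x [x' [_ ->]]]] /=.
  by rewrite /v; case: (h _).
apply: (Gmax G').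
  split; first by move=> z Gz; left.
  move=> sub; have : G ((pt true (c0 0%N), pt true (c0 0%N)),
      sval (v true true (c0 0%N) (c0 0%N))).
    by apply: sub; right; exists true, true, (c0 0%N), (c0 0%N).
  by move=> /Gfld[/ptA].
split.
- move=> p t t' [Gp|[b [b' [x [x' [bb [E ->]]]]]]] [Gp'|[d [d' [y [y' [dd [E' ->]]]]]]].
  + exact: Gf Gp Gp'.
  + have [/= + + _] := Gfld _ _ Gp; rewrite E' => /ptA db /ptA db'.
    by rewrite db db' in dd.
  + have [/= + + _] := Gfld _ _ Gp'; rewrite E => /ptA db /ptA db'.
    by rewrite db db' in bb.
  + by move: E'; rewrite E => -[/ptI[-> ->] /ptI[-> ->]].
- move=> p p' t /G'G[[Gp /= ft]|[/= nft [b [b' [x [x' [bb [-> E]]]]]]]]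
    /G'G[[Gp' /= ft']|[/= nft' [d [d' [y [y' [dd [-> E']]]]]]]] //.
  + exact: Gi Gp Gp'.
  + by move: E; rewrite E' => /sinj/vI[-> -> -> ->].
- move=> p t [/Gfld[/= /fldG ? /fldG ? /fldG ?] //|[b [b' [x [x' [bb [-> ->]]]]]]] /=.
  split; apply/fld'; [by exists b, x|by exists b', x'|].
  by exists true, (g (c0 (b.*2 + b')%N, g (x, x'))).
- move=> s t /fld'[b [x ->]] /fld'[b' [x' ->]].
  case: (boolP (b || b')) => [bb|].
    by exists (sval (v b b' x x')); right; exists b, b', x, x'.
  by case: b b' => [] [] //= _; exists (sval (g (x, x'))); left; exact: (gG (x, x')).
- by move=> p t _ i; exact: fldG.
Qed.
End Square.

Lemma embeds_sum_square A : embeds nat A -> embeds (A + A) (A * A).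
Proof.
move=> [e eI]; exists (fun z => match z with inl x => (e 0%N, x) | inr x => (e 1%N, x) end).
by move=> [x|x] [y|y] // => [[->]|[/eI]|[/eI]|[->]].
Qed.

Lemma embeds_sumS A B C D : embeds A C -> embeds B D -> embeds (A + B) (C + D).
Proof.
move=> [f fI] [g gI].
exists (fun z => match z with inl x => inl (f x) | inr x => inr (g x) end).
by move=> [x|x] [y|y] //= => [[/fI ->]|[/gI ->]].
Qed.

(** A sequence is determined by its length and by the iterated pairing of its
   entries. *)
Lemma embeds_seq S : embeds nat S -> embeds (seq S) S.
Proof.
move=> [e eI]; have [f fI] := embeds_square eI.
exists (fun s => f (e (size s), foldr (fun x y => f (x, y)) (e 0%N) s)).
move=> s t /fI[/eI]; elim: s t => [|x s IHs] [|y t] //= [st] /fI[-> st'].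
by rewrite (IHs t).
Qed.

(** Trees are coded by sequences of letters and node labels. *)
Lemma embeds_tree S : embeds nat S -> embeds (GenTree.tree S) S.
Proof.
move=> eS; apply: (@embeds_trans (seq S)) (embeds_seq eS).
have [f fI] : embeds (nat + S) S.
  apply: (@embeds_trans (S + S)); first by apply: embeds_sumS => //; exists id.
  by apply: embeds_trans (embeds_sum_square eS) _; case: eS => e; exact: embeds_square.
exists (fun t => map f (GenTree.encode t)) => s t /(inj_map fI).
exact: (pcan_inj (@GenTree.codeK S)).
Qed.

(** By [embeds_total], this means that [A] has a smaller cardinality than [K]. *)
Definition below (K A : Type) := ~ embeds K A.

Lemma below_embeds K A B : embeds A B -> below K B -> below K A.
Proof. by move=> AB KB KA; apply: KB; exact: embeds_trans AB. Qed.

(** By comparability, the sum embeds into two copies of the larger summand, hence into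
   the square of this summand or of [nat]. *)
Lemma below_sum K A B : below K nat -> below K A -> below K B -> below K (A + B).
Proof.
move=> Kn; wlog : A B / embeds A B => [W KA KB|AB KA KB].
  have [AB|BA] := embeds_total A B; first exact: W.
  apply: below_embeds (W _ _ BA KB KA).
  exists (fun z => match z with inl x => inr x | inr x => inl x end).
  by move=> [x|x] [y|y] // [->].
have idE (C : Type) : embeds C C by exists id.
have [nB|Bn] := embeds_total nat B.
  apply: below_embeds KB; apply: embeds_trans (embeds_sumS AB (idE B)) _.
  apply: embeds_trans (embeds_sum_square nB) _.
  by case: nB => e; exact: embeds_square.
apply: below_embeds Kn.
apply: embeds_trans (embeds_sumS (embeds_trans AB Bn) Bn) _.
apply: embeds_trans (embeds_sum_square (idE nat)) _.
exact: (@embeds_square nat id).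
Qed.

Lemma below_tree K A : below K nat -> below K A -> below K (GenTree.tree (nat + A)).
Proof.
move=> Kn KA; apply: below_embeds (below_sum Kn Kn KA).
by apply: embeds_tree; exists inl => x y [].
Qed.

Lemma small_setU K U (A B : set U) : below K nat ->
  small K A -> small K B -> small K (A `|` B).
Proof.
move=> Kn /smallE KA /smallE KB; apply/smallE.
apply: below_embeds (below_sum Kn KA KB).
have /choice[g gP] : forall x : sig (A `|` B), exists z : sig A + sig B,
    sval x = match z with inl y => sval y | inr y => sval y end.
  by move=> [x [Ax|Bx]]; [exists (inl (exist _ x Ax))|exists (inr (exist _ x Bx))].
exists g => x y gxy; have := gP x; rewrite gxy -gP.
by case: x y {gxy} => [x Px] [y Py] /= xy; subst; congr exist.
Qed.

Lemma small_range K U V (f : V -> U) : below K V -> small K (range f).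
Proof.
move=> KV; apply/smallE; apply: below_embeds KV.
have /choice[g gP] : forall x : sig (range f), exists v, f v = sval x.
  by move=> [x Px]; have [v _ fv] := Px; exists v.
exists g => x y gxy; have := gP x; rewrite gxy gP.
by case: x y {gxy} => [x Px] [y Py] /= xy; subst; congr exist.
Qed.

(** * Formulas and definable sets *)

Section Formulas.
Context {L : language}.

Lemma eval_rename (M : structure L) (V W : Type) (h : V -> W) (t : term L V)
    (v : W -> M) :
  Defs.eval v (term_rename h t) = Defs.eval (v \o h) t.
Proof.
by elim: t => [x|s u IHu] //=; congr fun_interp; apply: funext => i; exact: IHu.
Qed.

Lemma sat_rename (M : structure L) (V W : Type) (h : V -> W) (phi : formula L V)
    (v : W -> M) :
  sat (rename h phi) v <-> sat phi (v \o h).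
Proof.
elim: phi W h v => [V' t u|V' s u|V' p IHp|V' p IHp q IHq|V' p IHp] W h v /=.
- by rewrite !eval_rename.
- by under eq_fun do rewrite eval_rename.
- by split=> H /IHp.
- by rewrite IHp IHq.
- have E a : oapp v a \o omap h = oapp (v \o h) a.
    by apply: funext => -[].
  by split=> -[a]; [move=> /IHp|move=> Ha]; exists a; [|apply/IHp]; rewrite ?E // -E.
Qed.

Lemma finite_term_support (V : Type) (t : term L V) : exists2 S : set V, finite_set S &
  forall (M : structure L) (v v' : V -> M), (forall x, S x -> v x = v' x) ->
    Defs.eval v t = Defs.eval v' t.
Proof.
elim: t => [x|s u IHu]; first by exists [set x] => // M v v'; apply.
have /choice[S SP] : forall i, exists S : set V, finite_set S /\
    forall (M : structure L) (v v' : V -> M), (forall x, S x -> v x = v' x) ->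
    Defs.eval v (u i) = Defs.eval v' (u i).
  by move=> i; have [S ? ?] := IHu i; exists S.
exists (\bigcup_i S i); first by apply: bigcup_finite => // i _; exact: (SP i).1.
move=> M v v' vv' /=; congr fun_interp; apply: funext => i.
by apply: (SP i).2 => x Sx; apply: vv'; exists i.
Qed.

(** A quantifier adds one [option] layer to the type of variables; taking preimages by
   [Some] removes it from the support. *)
Lemma finite_support (V : Type) (phi : formula L V) : exists2 S : set V, finite_set S &
  forall (M : structure L) (v v' : V -> M), (forall x, S x -> v x = v' x) ->
    sat phi v <-> sat phi v'.
Proof.
elim: phi => [{}V t u|{}V s u|{}V p [S Sf SP]|{}V p [S Sf SP] q [S' S'f S'P]|{}V p [S Sf SP]].
- have [S Sf SP] := finite_term_support t; have [S' S'f S'P] := finite_term_support u.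
  exists (S `|` S'); first by rewrite finite_setU.
  move=> M v v' vv' /=; rewrite (SP _ v v'); last by move=> x Sx; apply: vv'; left.
  by rewrite (S'P _ v v') // => x Sx; apply: vv'; right.
- have /choice[S SP] : forall i, exists S : set V, finite_set S /\
      forall (M : structure L) (v v' : V -> M), (forall x, S x -> v x = v' x) ->
      Defs.eval v (u i) = Defs.eval v' (u i).
    by move=> i; have [S ? ?] := finite_term_support (u i); exists S.
  exists (\bigcup_i S i); first by apply: bigcup_finite => // i _; exact: (SP i).1.
  move=> M v v' vv' /=.
  suff -> : (fun i => Defs.eval v (u i)) = (fun i => Defs.eval v' (u i)) by [].
  by apply: funext => i; apply: (SP i).2 => x Sx; apply: vv'; exists i.
- by exists S => // M v v' vv' /=; rewrite (SP _ v v').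
- exists (S `|` S'); first by rewrite finite_setU.
  move=> M v v' vv' /=; rewrite (SP _ v v'); last by move=> x Sx; apply: vv'; left.
  by rewrite (S'P _ v v') // => x Sx; apply: vv'; right.
- exists (Some @^-1` S); first by apply: finite_preimage => // x y _ _ [].
  move=> M v v' vv' /=.
  have E a : sat p (oapp v a) <-> sat p (oapp v' a) by apply: SP => -[x|] // /vv'.
  by split=> -[a /E]; exists a.
Qed.

(** Only the parameters in a finite support of the formula matter. *)
Lemma finite_parameters (W P : Type) (phi : formula L (W + P)%type) :
  exists m (phi' : formula L (W + 'I_m)%type) (d : 'I_m -> P),
    forall (M : structure L) (w : W -> M) (p : P -> M),
      sat phi (w +++ p) <-> sat phi' (w +++ (p \o d)).
Proof.
have [S Sf SP] := finite_support phi.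
have [[p0 _]|P0] := pselect (exists p : P, True); last first.
  have E (p : P) : False by apply: P0; exists p.
  exists 0%N, (rename (fun z => match z with
                      | inl w => inl w
                      | inr p => False_rect _ (E p)
                      end) phi).
  exists (fun i : 'I_0 => False_rect _ (notF (ltn_ord i))) => M w p.
  by rewrite sat_rename; apply: SP => -[//|q]; case: (E q).
have : finite_set (inr @^-1` S) by apply: finite_preimage => // x y _ _ [].
elim/Peq : P => P in phi p0 S Sf SP *.
move=> /finite_seqP[s sE].
have idx p : (index p (p0 :: s) < (size (p0 :: s)).+1)%N by rewrite ltnS index_size.
(* the values on parameters outside the support are irrelevant: [index] sends them past
   the end of the list, which is the reason for the successor *)
exists (size (p0 :: s)).+1.
exists (rename (fun z => match z with
                | inl w => inl w
                | inr p => inr (Ordinal (idx p))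
                end) phi).
exists (fun i : 'I_(size (p0 :: s)).+1 => nth p0 (p0 :: s) i) => M w p.
rewrite sat_rename; apply: SP => -[//|q Sq].
have qs : q \in s by have : [set` s] q by rewrite -sE.
by rewrite /concat [RHS]/= nth_index // inE qs orbT.
Qed.

End Formulas.

Section Definable.
Context {L : language} {M : structure L} (A : set M).

Lemma definable_sat (J V : Type) (phi : formula L V) (h : V -> J) :
  definable_over A [set v : J -> M | sat phi (v \o h)].
Proof.
exists (rename (inl \o h) phi); apply/seteqP.
by split=> v; rewrite /psat /= sat_rename.
Qed.

Lemma definable_reindex (J J' : Type) (h : J -> J') (D : set (J -> M)) :
  definable_over A D -> definable_over A [set v : J' -> M | D (v \o h)].
Proof.
move=> [phi ->]; exists (rename ((inl \o h) +++ inr) phi).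
have E (v : J' -> M) : (v +++ @sval M A) \o ((inl \o h) +++ inr) = (v \o h) +++ sval.
  by apply: funext => -[].
by apply/seteqP; split=> v; rewrite /psat /= sat_rename E.
Qed.

Lemma definable_not (J : Type) (D : set (J -> M)) :
  definable_over A D -> definable_over A (~` D).
Proof. by move=> [phi ->]; exists (fNot phi). Qed.

Lemma definable_setU (J : Type) (D D' : set (J -> M)) :
  definable_over A D -> definable_over A D' -> definable_over A (D `|` D').
Proof. by move=> [phi ->] [psi ->]; exists (fOr phi psi). Qed.

Lemma definable_setI (J : Type) (D D' : set (J -> M)) :
  definable_over A D -> definable_over A D' -> definable_over A (D `&` D').
Proof.
move=> dD dD'; rewrite -[D `&` D']setCK setCI.
by apply/definable_not/definable_setU; exact: definable_not.
Qed.

Lemma definable_cst (J : Type) (P : Prop) : definable_over A [set v : J -> M | P].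
Proof.
have T : definable_over A [set: J -> M].
  exists (fEx (fEq (tVar L None) (tVar L None))).
  by apply/seteqP; split=> // v _; exists point.
have [p|np] := pselect P; first by rewrite (_ : [set _ | _] = setT) //; apply/seteqP; split.
by rewrite (_ : [set _ | _] = ~` setT); [exact: definable_not|apply/seteqP; split=> // v []].
Qed.

Lemma definable_exists (J : Type) (D : set (option J -> M)) :
  definable_over A D -> definable_over A [set v : J -> M | exists a, D (oapp v a)].
Proof.
move=> [phi ->].
pose h (z : option J + sig A) : option (J + sig A) :=
  match z with inl o => omap inl o | inr p => Some (inr p) end.
have E (v : J -> M) a :
    sat (rename h phi) (oapp (v +++ sval) a) <-> sat phi (oapp v a +++ sval).
  rewrite sat_rename.
  by have -> : oapp (v +++ sval) a \o h = oapp v a +++ sval by apply: funext => -[[]|].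
by exists (fEx (rename h phi)); apply/seteqP; split=> v [a /E Ha]; exists a.
Qed.

Lemma definable_exists_tuple (J : Type) m (D : set (J + 'I_m -> M)) :
  definable_over A D -> definable_over A [set v : J -> M | exists b, D (v +++ b)].
Proof.
elim: m D => [|m IHm] D dD.
  have E0 (b : 'I_0 -> M) : b = fun=> point by apply: funext => -[].
  pose k (z : J + 'I_0) : J :=
    match z with inl j => j | inr i => False_rect _ (notF (ltn_ord i)) end.
  rewrite (_ : [set _ | _] = [set v : J -> M | D (v \o k)]); first exact: definable_reindex.
  have E (v : J -> M) b : v \o k = v +++ b by apply: funext => -[//|[]].
  apply/seteqP; split=> v; first by move=> [b]; rewrite -(E v b).
  by rewrite /= (E v (fun=> point)); exists (fun=> point).
pose k (z : J + 'I_m.+1) : option (J + 'I_m) :=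
  match z with inl j => Some (inl j) | inr i => omap inr (unlift ord0 i) end.
have := IHm _ (definable_exists (definable_reindex k dD)).
congr (definable_over A _); apply/seteqP; split=> v /=.
  move=> [b [a Dab]]; exists (fun i => oapp b a (unlift ord0 i)).
  congr (D _) : Dab; apply: funext => -[//|i] /=.
  by case: (unlift ord0 i).
move=> [b Db]; exists (fun i => b (lift ord0 i)), (b ord0).
congr (D _) : Db; apply: funext => -[//|i] /=.
by case: unliftP => [j ->|->].
Qed.

Lemma definable_forall_tuple (J : Type) m (D : set (J + 'I_m -> M)) :
  definable_over A D -> definable_over A [set v : J -> M | forall b, D (v +++ b)].
Proof.
move=> dD; rewrite (_ : [set _ | _] = ~` [set v | exists b, (~` D) (v +++ b)]).
  by apply/definable_not/definable_exists_tuple/definable_not.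
apply/seteqP; split=> v /=; first by move=> H [b]; apply.
by move=> /forallNP H b; apply: contrapT; exact: H.
Qed.

Lemma definable_bigcup_fin (J : Type) (F : finType) (P : F -> Prop) (D : F -> set (J -> M)) :
  (forall f, P f -> definable_over A (D f)) ->
  definable_over A [set v | exists2 f, P f & D f v].
Proof.
move=> dD; rewrite (_ : [set _ | _] = \big[setU/set0]_(f <- enum F | `[< P f >]) D f).
  elim/big_ind: _ => [|X Y|f /asboolP /dD //]; last exact: definable_setU.
  by have := @definable_cst J False; congr (definable_over A _); apply/seteqP; split.
rewrite -bigcup_seq_cond; apply/seteqP; split=> v [f].
  by move=> Pf Df; exists f => //=; rewrite mem_enum /=; apply/asboolP.
by move=> /andP[_ /asboolP Pf] Df; exists f.
Qed.

Lemma definable_bigcap_fin (J : Type) (F : finType) (D : F -> set (J -> M)) :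
  (forall f, definable_over A (D f)) ->
  definable_over A [set v | forall f, D f v].
Proof.
move=> dD; have := definable_not (@definable_bigcup_fin J F xpredT (fun f => ~` D f)
  (fun f _ => definable_not (dD f))).
congr (definable_over A _); apply/seteqP; split=> v /=.
  by move=> /forall2NP H f; have [//|/contrapT] := H f.
by move=> H [f _]; apply.
Qed.

Definition truth (J : Type) (F : finType) (D : F -> set (J -> M)) (v : J -> M) :
  {ffun F -> bool} := [ffun f => `[< D f v >]].

(** A condition on the truth values of finitely many definable properties is a finite
   disjunction over the truth vectors that satisfy it. *)
Lemma definable_truth (J : Type) (F : finType) (D : F -> set (J -> M))
    (Q : {ffun F -> bool} -> Prop) :
  (forall f, definable_over A (D f)) ->
  definable_over A [set v | Q (truth D v)].
Proof.
move=> dD; have dt (t : {ffun F -> bool}) f :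
    definable_over A [set v : J -> M | t f <-> D f v].
  case: (t f).
    have := dD f; congr (definable_over A _).
    by apply/seteqP; split=> v /=; [move=> Dv; split|move=> [H _]; exact: H].
  have := definable_not (dD f); congr (definable_over A _).
  by apply/seteqP; split=> v /=; [move=> nD; split|move=> [_ H] /H].
rewrite (_ : [set _ | _] = [set v | exists2 t, Q t & forall f, t f <-> D f v]); last first.
  apply/seteqP; split=> v.
    by move=> Qv; exists (truth D v) => // f; rewrite ffunE; split=> /asboolP.
  move=> [t Qt Dt] /=; suff -> : truth D v = t by [].
  by apply/ffunP => f; rewrite ffunE; apply/asboolP/idP => /Dt.
apply: (@definable_bigcup_fin J {ffun F -> bool} Q
  (fun t => [set v | forall f, t f <-> D f v])).
by move=> t _; exact: (@definable_bigcap_fin _ _ (fun f => [set v | t f <-> D f v])).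
Qed.

Lemma definable_inst I m (phi : formula L (I + 'I_m)%type) (d : 'I_m -> M) :
  (forall i, A (d i)) -> definable_over A (inst phi d).
Proof.
move=> dA; exists (rename (inl +++ (inr \o (fun i => exist A (d i) (dA i)))) phi).
apply/seteqP; split=> v; rewrite /inst /psat /= sat_rename;
  by have -> : (v +++ sval) \o (inl +++ (inr \o (fun i => exist A (d i) (dA i)))) = v +++ d
    by apply: funext => -[].
Qed.

Lemma definableP I (D : set (I -> M)) : definable_over A D ->
  exists m (phi : formula L (I + 'I_m)%type) (d : 'I_m -> M),
    (forall i, A (d i)) /\ D = inst phi d.
Proof.
move=> [psi ->]; have [m [phi [d phiP]]] := finite_parameters psi.
exists m, phi, (sval \o d); split=> [i|]; first exact: svalP.
by apply/seteqP; split=> v; rewrite /inst /psat /= phiP.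
Qed.

End Definable.

Lemma definable_over_sub L (M : structure L) (A B : set M) J (D : set (J -> M)) :
  A `<=` B -> definable_over A D -> definable_over B D.
Proof.
move=> AB /definableP[m [phi [d [dA ->]]]].
by apply: definable_inst => i; exact: AB.
Qed.

(** * Downward Loewenheim-Skolem *)

Section Codes.
Context (L : language) (B : Type).

(** The letters of the trees into which formulas, Skolem terms and indices of codes are
   embedded. The natural numbers serve for variables and arities. *)
Definition alphabet := (nat + ((fun_symbol L + rel_symbol L) + B))%type.
Local Notation tree := (GenTree.tree alphabet).

Fixpoint term_code V (e : V -> tree) (t : term L V) : tree :=
  match t with
  | tVar v => GenTree.Node 0 [:: e v]
  | tFun s u => GenTree.Node 1 (GenTree.Leaf (inr (inl (inl s))) ::
                                [seq term_code e (u i) | i <- enum 'I_(fun_arity s)])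
  end.

(** Under a quantifier, the trees of the bound variable and of the old variables are
   given different node labels. *)
Fixpoint formula_code V (e : V -> tree) (phi : formula L V) : tree :=
  match phi with
  | fEq t u => GenTree.Node 0 [:: term_code e t; term_code e u]
  | fRel s u => GenTree.Node 1 (GenTree.Leaf (inr (inl (inr s))) ::
                                [seq term_code e (u i) | i <- enum 'I_(rel_arity s)])
  | fNot p => GenTree.Node 2 [:: formula_code e p]
  | fOr p q => GenTree.Node 3 [:: formula_code e p; formula_code e q]
  | fEx p => GenTree.Node 4 [:: formula_code
      (fun o => oapp (fun v => GenTree.Node 1 [:: e v]) (GenTree.Node 0 [::]) o) p]
  end.

Lemma eq_map_enum n (T U : Type) (f : T -> U) (u u' : 'I_n -> T) :
  (forall i t, f (u i) = f t -> u i = t) ->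
  [seq f (u i) | i <- enum 'I_n] = [seq f (u' i) | i <- enum 'I_n] -> u = u'.
Proof.
move=> fI /eq_in_map E; apply: funext => i; apply: fI.
by apply: E; rewrite mem_enum.
Qed.

Lemma term_code_inj V (e : V -> tree) : injective e -> injective (term_code e).
Proof.
move=> eI; elim=> [v|s u IHu] [w|s' u'] //= [].
  by move=> /eI ->.
move=> ss'; subst s'.
by move=> /(eq_map_enum IHu) ->.
Qed.

Lemma formula_code_inj V (e : V -> tree) : injective e -> injective (formula_code e).
Proof.
move=> eI phi; elim: phi e eI => [{}V t u|{}V s u|{}V p IHp|{}V p IHp q IHq|{}V p IHp]
  e eI psi.
- case: psi => //= t' u' [].
  by move=> /(term_code_inj eI) -> /(term_code_inj eI) ->.
- case: psi => //= s' u' [] ss'; subst s'.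
  by move=> /(eq_map_enum (fun i t => @term_code_inj _ _ eI (u i) t)) ->.
- by case: psi => //= p' [] /(IHp _ eI) ->.
- by case: psi => //= p' q' [] /(IHp _ eI) -> /(IHq _ eI) ->.
- case: psi => //= p' [] /IHp -> //.
  by move=> [x|] [y|] //= [/eI ->].
Qed.

End Codes.

Section Small.
Context (K : Type) {L : language}.
Hypotheses (Kn : below K nat) (Kf : below K (fun_symbol L)) (Kr : below K (rel_symbol L)).

Lemma below_code (B : Type) : below K B -> below K (GenTree.tree (alphabet L B)).
Proof. by move=> KB; apply: below_tree => //; do !apply: below_sum. Qed.

Context {M : structure L}.

Section Skolem.
Variable A : set M.

(** A Skolem hull as the set of values of the terms of an inductive type, so that
   embedding the terms into trees bounds its cardinality. The unique variable in
   [unit] is the one for which a witness is taken. *)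
Inductive skolem : Type :=
| SkParam of sig A
| SkWitness m (phi : formula L (unit + 'I_m)%type) of 'I_m -> skolem.

Fixpoint skolem_eval (t : skolem) : M :=
  match t with
  | SkParam a => sval a
  | SkWitness m phi u =>
      xget point [set x | sat phi ((fun=> x) +++ (fun i => skolem_eval (u i)))]
  end.

Fixpoint skolem_code (t : skolem) : GenTree.tree (alphabet L (sig A)) :=
  match t with
  | SkParam a => GenTree.Leaf (inr (inr a))
  | SkWitness m phi u => GenTree.Node 0 [:: GenTree.Leaf (inl m),
      formula_code (fun z => GenTree.Leaf (inl (pickle z))) phi &
      [seq skolem_code (u i) | i <- enum 'I_m]]
  end.

Lemma skolem_code_inj : injective skolem_code.
Proof.
elim=> [a|m phi u IHu] [b|n psi v] //= [].
  by move=> ->.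
move=> mn; subst n => /formula_code_inj <-.
  by move=> /(eq_map_enum IHu) ->.
by move=> x y [] /(pcan_inj pickleK).
Qed.

Lemma below_skolem : small K A -> below K skolem.
Proof.
move=> /smallE KA; apply: below_embeds (below_code KA).
by exists skolem_code; exact: skolem_code_inj.
Qed.

(** Finitely many parameters of [p] are values of terms, so the witness is one too. *)
Lemma skolem_closed V (p : formula L (option V)) (v : V -> M) :
  (forall x, range skolem_eval (v x)) -> (exists a, sat p (oapp v a)) ->
  exists2 a, range skolem_eval a & sat p (oapp v a).
Proof.
move=> vB [a pa].
pose h (o : option V) : unit + V := if o is Some x then inr x else inl tt.
have E (b : M) : ((fun=> b) +++ v) \o h = oapp v b by apply: funext => -[].
have [m [phi [d phiP]]] := finite_parameters (rename h p).
have pE (b : M) : sat p (oapp v b) <-> sat phi ((fun=> b) +++ (v \o d)).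
  by rewrite -phiP sat_rename E.
have /choice[u uE] : forall i, exists t, skolem_eval t = v (d i).
  by move=> i; have [t _ <-] := vB (d i); exists t.
have uE' : (fun i => skolem_eval (u i)) = v \o d by apply: funext.
exists (skolem_eval (SkWitness phi u)); first by exists (SkWitness phi u).
apply/pE => /=; rewrite uE'.
by have /pE := pa; exact: (@xgetI _ point [set b | sat phi ((fun=> b) +++ (v \o d))]).
Qed.

End Skolem.

(** The Tarski-Vaught test for the Skolem hull of [A], whose closure under witnesses
   also gives its closure under the functions of [L]. *)
Lemma small_model_containing (A : set M) : small K A ->
  exists2 B, A `<=` B & small_model K B.
Proof.
move=> KA; pose B : set M := range (skolem_eval (A := A)).
exists B; first by move=> a Aa; exists (SkParam (exist _ a Aa)).
split; first by apply/small_range/below_skolem.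
have point_in : B (skolem_eval
  (SkWitness (fEx (fEq (tVar L None) (tVar L None)) : formula L (unit + 'I_0))
    (fun i : 'I_0 => False_rect (skolem A) (notF (ltn_ord i))))) by eexists.
have fun_in s (u : 'I_(fun_arity s) -> sig B) : B (fun_interp (fun i => sval (u i))).
  have [||a Ba /= <-//] := @skolem_closed A _
    (fEq (tVar L None) (tFun (fun i => tVar L (Some i)))) (fun i => sval (u i)).
    by move=> i; exact: svalP.
  by exists (fun_interp (fun i => sval (u i))).
pose N0 : pointedType := HB.pack (sig B) (gen_eqMixin (sig B)) (gen_choiceMixin (sig B))
  (isPointed.Build (sig B) (exist _ _ point_in)).
pose N : structure L := @Structure L N0 (fun s u => exist _ _ (fun_in s u))
  (fun s u => rel_interp (fun i => sval (u i))).
exists N, (@sval M B); split; last first.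
  by apply/seteqP; split=> [_ [[a Ba] _ <-] //|a Ba]; exists (exist _ a Ba).
have evalE V (t : term L V) (v : V -> N) : sval (Defs.eval v t) = Defs.eval (sval \o v) t.
  elim: t => [x|s u IHu] //=; congr fun_interp; apply: funext => i; exact: IHu.
suff satE V (p : formula L V) (v : V -> N) : sat p v <-> sat p (sval \o v).
  by move=> k phi v; exact: satE.
elim: p v => [{}V t u|{}V s u|{}V p IHp|{}V p IHp q IHq|{}V p IHp] v /=.
- rewrite -!evalE; split=> [->//|].
  case: (Defs.eval v t) (Defs.eval v u) => [a Ba] [b Bb] /= ab; subst b.
  by congr exist.
- by under eq_fun do rewrite evalE.
- by rewrite IHp.
- by rewrite IHp IHq.
- have E (a : N) : sval \o oapp v a = oapp (sval \o v) (sval a) by apply: funext => -[].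
  split=> [[a /IHp]|ex]; first by rewrite E; exists (sval a).
  have [a Ba pa] := @skolem_closed A _ _ (sval \o v) (fun x => svalP (v x)) ex.
  by exists (exist _ a Ba); apply/IHp; rewrite E.
Qed.

End Small.

(** * Stone spaces over small sets *)

Section Stone.
Context (K : Type) {L : language} {M : structure L} {A : set M} {J : finType}.
Hypotheses (satM : saturated K M) (KA : small K A).

Lemma realizationP (q : stone A J) : realizes (realization q) q.
Proof.
by have [b bq] := satM KA q; exact: (@xgetI _ point [set b | realizes b q] b bq).
Qed.

Lemma psat_realization (phi : pformula A J) (q : stone A J) :
  psat phi (realization q) <-> sval q phi.
Proof.
split=> [|/realizationP //]; case: (svalP q) => _ /(_ phi)[//|/realizationP].
by rewrite /psat /=.
Qed.

Lemma realization_inj (q q' : stone A J) :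
  (forall phi, psat (A := A) phi (realization q) <-> psat phi (realization q')) -> q = q'.
Proof.
move=> qq'; have : sval q = sval q'.
  by apply: funext => phi; apply: propext; rewrite -!psat_realization.
by case: q q' {qq'} => [p pP] [p' pP'] /= pp'; subst p'; congr exist.
Qed.

Lemma tp_realization (b : J -> M) (phi : pformula A J) :
  psat phi (realization (tp A b)) <-> psat phi b.
Proof. exact: psat_realization. Qed.

(** For [A]-definable [D], this is the clopen set of the types that contain [D]; going
   through realizations avoids the choice of a formula. *)
Definition cl (D : set (J -> M)) : set (stone A J) := [set q | D (realization q)].

Lemma cl_psat (phi : pformula A J) : cl [set b | psat phi b] = clopen_of phi.
Proof. by apply/seteqP; split=> q /psat_realization. Qed.

Lemma cl_tp (D : set (J -> M)) b : definable_over A D -> cl D (tp A b) <-> D b.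
Proof. by move=> [phi ->]; exact: tp_realization. Qed.

Lemma open_clopen_of (phi : pformula A J) : open (clopen_of phi).
Proof.
exists [set clopen_of phi]; last by rewrite bigcup_set1.
move=> _ ->; exists [fset phi]%fset; first by move=> psi _; exact: mem_set.
by rewrite set_fset1 bigcap_set1.
Qed.

Lemma cl_open (D : set (J -> M)) : definable_over A D -> open (cl D).
Proof. by move=> [phi ->]; rewrite cl_psat; exact: open_clopen_of. Qed.

Lemma cl_closed (D : set (J -> M)) : definable_over A D -> closed (cl D).
Proof. by move=> dD; rewrite -openC; exact: (cl_open (definable_not dD)). Qed.

(** A basic open set is a finite intersection of sets [clopen_of phi], and definable
   sets are closed under finite intersections. *)
Lemma cl_base (U : set (stone A J)) q : open U -> U q ->
  exists D, [/\ definable_over A D, cl D q & cl D `<=` U].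
Proof.
move=> [B BfinI <-] [X BX Xq]; have [F0 _ F0X] := BfinI _ BX.
have [F FX] : exists F : {fset pformula A J}, \bigcap_(phi in [set` F]) clopen_of phi = X.
  by exists F0.
exists [set b | forall phi : F, psat (val phi) b]; split.
- apply: (@definable_bigcap_fin _ _ _ _ F (fun phi b => psat (val phi) b)) => phi.
  by exists (val phi).
- by move=> phi; have : X q by []; rewrite -FX => /(_ _ (fsvalP phi)) /psat_realization.
- move=> q' q'D; exists X => //; suff : X q' by []; rewrite -FX => phi Fphi.
  by apply/psat_realization; exact: (q'D (FSetSub Fphi)).
Qed.

(** The [A]-formulas that belong to an ultrafilter finer than [F] form a complete type,
   which is realized by saturation. *)
Lemma realize_filter (F : set_system (J -> M)) : ProperFilter F ->
  exists b, forall D, definable_over A D -> F D -> D b.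
Proof.
move=> FF; have [G [UG FG]] := ultraFilterLemma FF.
have pP : complete_type (A := A) [set phi | G [set b | psat phi b]].
  split=> [k s Gs|phi].
    have /filter_ex[v vs] : G [set b | forall i, psat (s i) b] by exact: filter_forall.
    by exists v.
  have [|] := in_ultra_setVsetC [set b | psat phi b] UG; first by left.
  by right.
exists (realization (exist _ _ pP)) => D [phi ->] /FG Gphi.
by apply/psat_realization.
Qed.

(** For an ultrafilter on types, take a tuple given by [realize_filter] for its image
   under [realization]: its type is a limit. *)
Lemma stone_compact : compact [set: stone A J].
Proof.
rewrite compact_ultra => F UF _.
have [b bF] : exists b, forall D, definable_over A D -> F (cl D) -> D b.
  by have [b bF] := @realize_filter (@realization L M A J @ F) _; exists b.
exists (tp A b); split=> // U; rewrite nbhsE => -[V [oV Vb] VU].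
have [D [dD /cl_tp Db DV]] := cl_base oV Vb.
apply: filterS (subset_trans DV VU) _.
have [//|nFD] := in_ultra_setVsetC (cl D) UF.
by have := bF _ (definable_not dD) nFD; case; exact: Db.
Qed.

End Stone.

(** * Finitely additive measures on definable sets *)

Section KeislerTheory.
Context {R : realType} {L : language} {M : structure L} {J : Type}.
Variable nu : set (J -> M) -> R.
Hypothesis nuK : keisler_measure nu.

Lemma keisler_ge0 D : definable D -> 0 <= nu D.
Proof. by case: nuK => H _ _; exact: H. Qed.

Lemma keisler_setT : nu setT = 1.
Proof. by case: nuK. Qed.

Lemma keisler_setU D D' : definable D -> definable D' -> D `&` D' = set0 ->
  nu (D `|` D') = nu D + nu D'.
Proof. by case: nuK => _ _; apply. Qed.

Lemma definable0 : definable (set0 : set (J -> M)).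
Proof.
by have := @definable_cst L M setT J False; congr definable; apply/seteqP; split.
Qed.

Lemma keisler_set0 : nu set0 = 0.
Proof.
have := keisler_setU definable0 definable0 (setI0 _).
by rewrite setU0 => E; apply: (addrI (nu set0)); rewrite -E addr0.
Qed.

Lemma keisler_setID D D' : definable D -> definable D' ->
  nu D = nu (D `&` D') + nu (D `&` ~` D').
Proof.
move=> dD dD'; rewrite -keisler_setU; first by rewrite -setIUr setUCr setIT.
- exact: definable_setI.
- by apply: definable_setI => //; exact: definable_not.
- by rewrite setIACA setICr setI0.
Qed.

Lemma keisler_le D D' : definable D -> definable D' -> D `<=` D' -> nu D <= nu D'.
Proof.
move=> dD dD' DD'; rewrite (keisler_setID dD' dD) setIC (setIidl DD').
by rewrite lerDl keisler_ge0//; apply: definable_setI => //; exact: definable_not.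
Qed.

Lemma keisler_le1 D : definable D -> nu D <= 1.
Proof.
move=> dD; rewrite -keisler_setT; apply: keisler_le => //.
by rewrite -(setUCr D); exact/definable_setU/definable_not.
Qed.

Lemma keisler_setU_le D D' : definable D -> definable D' -> nu (D `|` D') <= nu D + nu D'.
Proof.
move=> dD dD'; have dDC := definable_not dD.
rewrite (_ : D `|` D' = D `|` (D' `&` ~` D)); last by rewrite setUIr setUCr setIT.
rewrite keisler_setU //; last 2 first.
- exact: definable_setI.
- by rewrite setICA setICr setI0.
by rewrite lerD2l; apply: keisler_le => //; exact: definable_setI.
Qed.

End KeislerTheory.

Lemma definableW L (M : structure L) (A : set M) J (D : set (J -> M)) :
  definable_over A D -> definable D.
Proof. exact: definable_over_sub. Qed.

(** * Regular Borel extensions *)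

Section RegularExtension.
Context {R : realType} (K : Type) {L : language} {M : structure L} {A : set M} {J : finType}.
Hypotheses (satM : saturated K M) (KA : small K A).
Variable nu : set (J -> M) -> R.
Hypothesis nuK : keisler_measure nu.
Local Open Scope ereal_scope.
Local Notation stone := (stone A J).
Local Notation cl := (@cl L M A J).

(** As in the Riesz representation theorem, open sets are measured from inside by
   clopen sets, and all sets from outside by open sets. Covers by countably many
   clopen sets would only reach the Baire sets, since an open set of a Stone space
   need not be a countable union of clopen sets. *)
Definition inner (U : set stone) : \bar R :=
  ereal_sup [set (nu D)%:E | D in [set D | definable_over A D /\ cl D `<=` U]].

Definition outer (B : set stone) : \bar R :=
  ereal_inf [set inner U | U in [set U | open U /\ B `<=` U]].

Lemma inner_le_intro U D : definable_over A D -> cl D `<=` U -> (nu D)%:E <= inner U.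
Proof. by move=> dD DU; apply: ereal_sup_ubound; exists D. Qed.

Lemma inner_ge0 U : 0 <= inner U.
Proof.
rewrite -[0]/(0%:E) -(keisler_set0 nuK); apply: inner_le_intro => //.
by have := @definable_cst L M A J False; congr definable_over; apply/seteqP; split.
Qed.

Lemma inner_sub U V : U `<=` V -> inner U <= inner V.
Proof.
move=> UV; apply: ge_ereal_sup => _ [D [dD DU] <-].
by apply: inner_le_intro => //; exact: subset_trans UV.
Qed.

Lemma inner_cl D : definable_over A D -> inner (cl D) = (nu D)%:E.
Proof.
move=> dD; apply/eqP; rewrite eq_le inner_le_intro // andbT.
apply: ge_ereal_sup => _ [D' [dD' D'D] <-]; rewrite lee_fin.
apply: (keisler_le nuK); [exact: definableW dD'|exact: definableW dD|].
by move=> b /(cl_tp satM KA b dD') /D'D /(cl_tp satM KA b dD).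
Qed.

Lemma outer_open U : open U -> outer U = inner U.
Proof.
move=> oU; apply/eqP; rewrite eq_le; apply/andP; split.
  by apply: ereal_inf_lbound; exists U; split.
by apply: le_ereal_inf_tmp => _ [V [oV UV] <-]; exact: inner_sub.
Qed.

Lemma outer_ge0 B : 0 <= outer B.
Proof. by apply: le_ereal_inf_tmp => _ [V [oV UV] <-]; exact: inner_ge0. Qed.

Lemma outer_le B U : open U -> B `<=` U -> outer B <= inner U.
Proof. by move=> oU BU; apply: ereal_inf_lbound; exists U. Qed.

Lemma outer_le1 B : outer B <= 1.
Proof.
apply: le_trans (outer_le openT (@subsetT _ B)) _.
apply: ge_ereal_sup => _ [D [dD _] <-]; rewrite lee_fin (keisler_le1 nuK) //.
exact: definableW dD.
Qed.

(** By compactness, finitely many basic sets, each inside one of the [U i], cover [D];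
   [E i] is the union of those that were chosen inside [U i]. *)
Lemma cl_cover (D : set (J -> M)) (U : nat -> set stone) :
  definable_over A D -> (forall i, open (U i)) -> cl D `<=` \bigcup_i U i ->
  exists n (E : nat -> set (J -> M)),
    (forall i, definable_over A (E i) /\ cl (E i) `<=` U i) /\
    D `<=` \bigcup_(i < n) E i.
Proof.
move=> dD oU DU.
have /choice[f fP] : forall q, exists iE : nat * set (J -> M), cl D q ->
    [/\ definable_over A iE.2, cl iE.2 q & cl iE.2 `<=` U iE.1].
  move=> q; have [Dq|nDq] := pselect (cl D q); last by exists (0%N, set0).
  have [i _ Uq] := DU _ Dq.
  by have [E [dE Eq EU]] := cl_base satM KA (oU i) Uq; exists (i, E).
have : compact (cl D).
  by apply: subclosed_compact (cl_closed satM KA dD) (stone_compact satM KA) _.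
rewrite compact_cover => /(_ _ (cl D) (fun q => cl (f q).2)) [|q Dq|F FD DF].
- by move=> q /fP[dE _ _]; exact: (cl_open satM KA dE).
- by exists q => //; have [] := fP q Dq.
exists (\max_(q : F) (f (val q)).1).+1.
exists (fun i => [set b | exists2 q : F, (f (val q)).1 = i & (f (val q)).2 b]); split.
  move=> i; split.
    apply: (@definable_bigcup_fin _ _ _ _ F
      (fun q => (f (val q)).1 = i) (fun q => (f (val q)).2)).
    by move=> q _; have [] := fP _ (set_mem (FD _ (fsvalP q))).
  move=> q [q' <-]; have [_ _] := fP _ (set_mem (FD _ (fsvalP q'))); exact.
move=> b /(cl_tp satM KA b dD) /DF [q Fq qb].
have [dE _ _] := fP _ (set_mem (FD _ Fq)).
exists (f q).1 => /=; last by exists (FSetSub Fq) => //; apply/(cl_tp satM KA b dE).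
by rewrite ltnS; exact: (@leq_bigmax _ (fun q : F => (f (val q)).1) (FSetSub Fq)).
Qed.

Lemma inner_bigcup (U : nat -> set stone) : (forall i, open (U i)) ->
  inner (\bigcup_i U i) <= \sum_(i <oo) inner (U i).
Proof.
move=> oU; apply: ge_ereal_sup => _ [D [dD DU] <-].
have [n [E [EP DE]]] := cl_cover dD oU DU.
have dE i : definable (E i) by exact: definableW (EP i).1.
apply: le_trans (nneseries_lim_ge n _); last by move=> i _ _; exact: inner_ge0.
apply: (@le_trans _ _ (nu (\big[setU/set0]_(i < n) E i))%:E).
  rewrite lee_fin; apply: (keisler_le nuK).
  - exact: definableW dD.
  - by elim/big_ind: _ => [|X Y|//]; [exact: definable0|exact: definable_setU].
  - by rewrite -(bigcup_mkord n E).
apply: (@le_trans _ _ (\sum_(0 <= i < n) (nu (E i))%:E)); last first.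
  by apply: lee_sum => i _; apply: inner_le_intro; have [] := EP i.
rewrite big_mkord; elim: n {DE} => [|n IHn]; first by rewrite !big_ord0 (keisler_set0 nuK).
rewrite !big_ord_recr /=; apply: le_trans (leeD2r _ IHn).
rewrite -EFinD lee_fin; apply: (keisler_setU_le nuK) => //.
by elim/big_ind: _ => [|X Y|//]; [exact: definable0|exact: definable_setU].
Qed.

Lemma outer_set0 : outer set0 = 0.
Proof.
rewrite outer_open; last exact: open0.
rewrite (_ : set0 = cl set0) // inner_cl ?(keisler_set0 nuK) //.
by have := @definable_cst L M A J False; congr definable_over; apply/seteqP; split.
Qed.

Lemma outer_fin_num B : outer B \is a fin_num.
Proof. by rewrite ge0_fin_numE ?outer_ge0 // (le_lt_trans (outer_le1 _)) // ltry. Qed.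

Lemma outer_sigma_subadditive : sigma_subadditive outer.
Proof.
move=> B; suff add2e (e : {posnum R}) :
    outer (\bigcup_n B n) <= \sum_(i <oo) outer (B i) + e%:num%:E.
  by apply/lee_addgt0Pr => _/posnumP[].
apply: le_trans (epsilon_trick _ _ _) => //; last by move=> n; exact: outer_ge0.
have /choice[U UP] : forall n, exists U, [/\ open U, B n `<=` U &
    inner U <= outer (B n) + (e%:num / (2 ^ n.+1)%:R)%:E].
  move=> n; have en : (0 < e%:num / (2 ^ n.+1)%:R :> R)%R by [].
  have [_ [U [oU BU] <-] /ltW UB] := lb_ereal_inf_adherent en (outer_fin_num (B n)).
  by exists U.
have oU n : open (U n) by have [] := UP n.
apply: (@le_trans _ _ (inner (\bigcup_n U n))).
  apply: outer_le; first exact: bigcup_open.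
  by move=> q [n _ Bq]; exists n => //; have [_ BU _] := UP n; exact: BU.
apply: le_trans (inner_bigcup oU) _; apply: lee_nneseries => n _.
  by move=> _; exact: inner_ge0.
by have [] := UP n.
Qed.

Lemma outer_mono : {homo outer : B C / B `<=` C >-> B <= C}.
Proof.
move=> B C BC; apply: le_ereal_inf_tmp => _ [V [oV CV] <-].
by apply: outer_le => //; exact: subset_trans CV.
Qed.

HB.instance Definition _ := isOuterMeasure.Build R stone outer outer_set0 outer_ge0
  outer_mono outer_sigma_subadditive.

(** It suffices to split an open set [V]. If [cl D] is contained in both [V] and [U] and
   [cl D'] in the open set of the points of [V] outside [cl D], then [D] and [D'] are
   disjoint and together contribute to the inner measure of [V]. *)
Lemma open_caratheodory U : open U -> outer.-caratheodory U.
Proof.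
move=> oU; apply: (@le_caratheodory_measurable _ _ outer) => X.
apply: le_ereal_inf_tmp => _ [V [oV XV] <-].
apply: (@le_trans _ _ (outer (V `&` U) + outer (V `&` ~` U))).
  by apply: leeD; apply: outer_mono; exact: setSI.
rewrite [X in X + _ <= _]outer_open; last exact: openI.
rewrite -leeBrDr ?outer_fin_num //.
apply: ge_ereal_sup => _ [D [dD DVU] <-]; rewrite leeBrDr ?outer_fin_num //.
apply: (@le_trans _ _ ((nu D)%:E + inner (V `&` ~` cl D))).
  rewrite leeD2l //; apply: outer_le.
    by apply: openI => //; rewrite openC; exact: (cl_closed satM KA dD).
  by apply: setIS; apply: subsetC => q /DVU[].
rewrite addeC -leeBrDr //; apply: ge_ereal_sup => _ [D' [dD' D'V] <-].
rewrite leeBrDr // -EFinD addrC -(keisler_setU nuK).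
- apply: inner_le_intro; first exact: definable_setU.
  by move=> q [/DVU[]|/D'V[]].
- exact: definableW dD.
- exact: definableW dD'.
- apply/seteqP; split=> // b [/(cl_tp satM KA b dD) Db /(cl_tp satM KA b dD') /D'V[_]].
  exact.
Qed.

Lemma borel_caratheodory (B : set stone) :
  measurable (B : set (borel_stone A J)) -> outer.-caratheodory B.
Proof.
move: B; suff : <<s @open stone >> `<=` outer.-caratheodory by [].
apply: smallest_sub; last exact: open_caratheodory.
split; first exact: (@caratheodory_measurable_set0 _ _ outer).
  by move=> X mX; rewrite setTD; exact: (@caratheodory_measurable_setC _ _ outer).
by move=> F mF; exact: (@caratheodory_measurable_bigcup _ _ outer).
Qed.

Definition borel_outer : set (borel_stone A J) -> \bar R := outer.

Lemma borel_outer_sigma_additive : semi_sigma_additive borel_outer.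
Proof.
move=> F mF tF mUF.
apply: (@caratheodory_measure_sigma_additive _ _ outer) => //.
- by move=> i; exact: (borel_caratheodory (mF i)).
- exact: borel_caratheodory mUF.
Qed.

HB.instance Definition _ := isMeasure.Build _ _ _ borel_outer outer_set0 outer_ge0
  borel_outer_sigma_additive.

Lemma borel_outer_setT : borel_outer setT = 1.
Proof.
rewrite /borel_outer outer_open; last exact: openT.
rewrite (_ : setT = cl setT) // inner_cl ?(keisler_setT nuK) //.
by have := @definable_cst L M A J True; congr definable_over; apply/seteqP; split.
Qed.

HB.instance Definition _ := Measure_isProbability.Build _ _ _ borel_outer borel_outer_setT.

(** Outer regularity holds by construction. Inner regularity of a set is the outer
   regularity of its complement, because closed sets are compact. *)
Lemma regular_extension_exists :
  exists P : probability (borel_stone A J) R, regular_extension nu P.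
Proof.
exists borel_outer; split; last first.
  move=> psi; rewrite -(cl_psat satM KA) /= /borel_outer outer_open.
    by rewrite inner_cl //; exists psi.
  by apply: (cl_open satM KA); exists psi.
have reg B : borel_outer B =
    ereal_inf [set borel_outer U | U in [set U : set stone | open U /\ B `<=` U]].
  rewrite [LHS]/borel_outer [LHS]/outer; congr ereal_inf; apply/seteqP.
  by split=> _ [U [oU BU] <-]; exists U => //; rewrite /borel_outer outer_open.
move=> B mB; split; first exact: reg.
have mO (U : set stone) : open U -> measurable (U : set (borel_stone A J)).
  by move=> oU; exact: sub_sigma_algebra.
have PC (U : set stone) : measurable (U : set (borel_stone A J)) ->
    borel_outer (~` U) = 1 - borel_outer U.
  by move=> mU; rewrite (@probability_setC _ _ _ borel_outer).
apply/eqP; rewrite eq_le; apply/andP; split; last first.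
  apply: ge_ereal_sup => _ [C [_ CB] <-]; exact: outer_mono.
apply/lee_addgt0Pr => e e0.
have [_ [U [oU BU] <-] UB] := lb_ereal_inf_adherent e0 (outer_fin_num (~` B)).
have mU := mO _ oU; have mBC : measurable (~` B : set (borel_stone A J)) by exact: measurableC.
apply: (@le_trans _ _ (borel_outer (~` U) + e%:E)); last first.
  rewrite leeD2r //; apply: ereal_sup_ubound; exists (~` U) => //.
  split; last by rewrite -[X in _ `<=` X]setCK; exact: subsetC.
  by apply: subclosed_compact (stone_compact satM KA) _ => //; rewrite closedC.
rewrite PC // -[X in borel_outer X <= _]setCK PC //.
have {}UB : inner U < outer (~` B) + e%:E := UB; move: UB.
rewrite /borel_outer (outer_open oU).
move: (outer_fin_num (~` B)) (outer_fin_num U); rewrite (outer_open oU).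
case: (outer (~` B)) => // x _; case: (inner U) => // y _.
rewrite -!EFinD lte_fin lee_fin => /ltW ?; lra.
Qed.

End RegularExtension.

(** * Finitely additive integration of step functions *)

Lemma definable_subst L (M : structure L) (A B : set M) (V J : Type) (D : set (V -> M))
    (s : V -> J + sig B) : A `<=` B -> definable_over A D ->
  definable_over B [set w : J -> M | D ((w +++ sval) \o s)].
Proof.
move=> AB [phi ->].
pose h (z : V + sig A) : J + sig B :=
  match z with inl v => s v | inr p => inr (exist _ (sval p) (AB _ (svalP p))) end.
exists (rename h phi); apply/seteqP.
suff E (w : J -> M) : (w +++ @sval M B) \o h = ((w +++ sval) \o s) +++ sval.
  by split=> w; rewrite /psat /= sat_rename E.
by apply: funext => -[].
Qed.

Lemma definable_fiberr L (M : structure L) (A B : set M) (I J : Type) (D : set (I + J -> M))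
    (a : I -> M) : A `<=` B -> (forall x, B (a x)) -> definable_over A D ->
  definable_over B [set b : J -> M | D (a +++ b)].
Proof.
move=> AB aB dD.
pose s (z : I + J) : J + sig B :=
  match z with inl x => inr (exist _ (a x) (aB x)) | inr y => inl y end.
have := definable_subst s AB dD; congr (definable_over B _).
have E (b : J -> M) : (b +++ @sval M B) \o s = a +++ b by apply: funext => -[].
by apply/seteqP; split=> b /=; rewrite E.
Qed.

Lemma definable_fiberl L (M : structure L) (A B : set M) (I J : Type) (D : set (I + J -> M))
    (b : J -> M) : A `<=` B -> (forall x, B (b x)) -> definable_over A D ->
  definable_over B [set a : I -> M | D (a +++ b)].
Proof.
move=> AB bB dD.
pose s (z : I + J) : I + sig B :=
  match z with inl x => inl x | inr y => inr (exist _ (b y) (bB y)) end.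
have := definable_subst s AB dD; congr (definable_over B _).
have E (a : I -> M) : (a +++ @sval M B) \o s = a +++ b by apply: funext => -[].
by apply/seteqP; split=> a /=; rewrite E.
Qed.

Lemma definableT {L} {M : structure L} {A : set M} {J : Type} :
  definable_over A [set: J -> M].
Proof. exact: (@definable_cst _ _ A J True). Qed.

Definition definable_map L (M : structure L) (A : set M) (J : Type) (F : finType)
  (t : (J -> M) -> F) := forall f, definable_over A [set b | t b = f].

Lemma definable_map_truth L (M : structure L) (A : set M) (J : Type) (F : finType)
    (D : F -> set (J -> M)) :
  (forall f, definable_over A (D f)) -> definable_map A (truth D).
Proof. by move=> dD t; exact: (@definable_truth _ _ _ _ _ D (fun s => s = t)). Qed.

Lemma definable_map_preimage L (M : structure L) (A : set M) (J : Type) (F : finType)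
    (t : (J -> M) -> F) (Q : F -> Prop) :
  definable_map A t -> definable_over A [set b | Q (t b)].
Proof.
move=> dt; rewrite (_ : [set _ | _] = [set b | exists2 f, Q f & t b = f]).
  exact: (@definable_bigcup_fin _ _ _ _ _ Q (fun f => [set b | t b = f])).
by apply/seteqP; split=> b; [exists (t b)|move=> [f Qf /= tb]; rewrite /= tb].
Qed.

Lemma definable_map_pair L (M : structure L) (A : set M) (J : Type) (F F' : finType)
    (t : (J -> M) -> F) (t' : (J -> M) -> F') :
  definable_map A t -> definable_map A t' -> definable_map A (fun b => (t b, t' b)).
Proof.
move=> dt dt' [f f']; rewrite (_ : [set _ | _] = [set b | t b = f] `&` [set b | t' b = f']).
  exact: definable_setI.
by apply/seteqP; split=> b /=; [move=> [-> ->]|move=> [-> ->]].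
Qed.

Section StepIntegral.
Context {R : realType} {L : language} {M : structure L} {J : Type}.
Variable nu : set (J -> M) -> R.
Hypothesis nuK : keisler_measure nu.

Definition step_int (F : finType) (t : (J -> M) -> F) (H : F -> R) : R :=
  \sum_f H f * nu [set b | t b = f].

Lemma keisler_partition (F : finType) (t : (J -> M) -> F) (D : set (J -> M)) :
  definable D -> definable_map setT t -> nu D = \sum_f nu (D `&` [set b | t b = f]).
Proof.
move=> dD dt.
suff E (s : seq F) : uniq s ->
    nu (D `&` [set b | t b \in s]) = \sum_(f <- s) nu (D `&` [set b | t b = f]).
  rewrite -big_enum /= -E ?enum_uniq //; congr nu; apply/seteqP.
  by split=> b; [move=> Db; split=> //=; rewrite mem_enum|move=> []].
elim: s => [_|f s IHs /= /andP[fs us]].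
  rewrite big_nil -[RHS](keisler_set0 nuK); congr nu.
  by apply/seteqP; split=> b // [].
rewrite big_cons -IHs // -(keisler_setU nuK).
- congr nu; apply/seteqP; split=> b /=.
    by move=> [Db]; rewrite inE => /orP[/eqP tf|ts]; [left|right].
  by move=> [[Db tb]|[Db tb]]; split=> //; rewrite inE ?tb ?eqxx // orbT.
- exact: definable_setI.
- apply: definable_setI => //.
  exact: (@definable_map_preimage _ _ _ _ _ t (fun x => x \in s)).
- apply/seteqP; split=> // b [[_ /= tb] [_ /=]]; rewrite tb; exact/negP.
Qed.

Lemma step_int_pair (F F' : finType) (t : (J -> M) -> F) (t' : (J -> M) -> F') H :
  definable_map setT t -> definable_map setT t' ->
  step_int t H = \sum_f \sum_f' H f * nu ([set b | t b = f] `&` [set b | t' b = f']).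
Proof.
move=> dt dt'; apply: eq_bigr => f _.
by rewrite -big_distrr /= -keisler_partition //; exact: dt.
Qed.

(** Both sums refine to the common partition, where a nonempty cell contributes at most
   [e] times its measure to the difference. *)
Lemma step_int_close (F F' : finType) (t : (J -> M) -> F) (t' : (J -> M) -> F') H H' e :
  definable_map setT t -> definable_map setT t' ->
  (forall b, `|H (t b) - H' (t' b)| <= e) ->
  `|step_int t H - step_int t' H'| <= e.
Proof.
move=> dt dt' HH'; rewrite (step_int_pair _ dt dt') (step_int_pair _ dt' dt).
rewrite [X in _ - X]exchange_big /= -sumrB.
under eq_bigr => f _ do rewrite -sumrB.
have -> : e = \sum_f \sum_f' e * nu ([set b | t b = f] `&` [set b | t' b = f']).
  rewrite -(step_int_pair (fun=> e) dt dt') /step_int -big_distrr /=.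
  rewrite -[LHS]mulr1 -(keisler_setT nuK) (keisler_partition definableT dt).
  by congr (_ * _); apply: eq_bigr => f _; rewrite setTI.
apply: le_trans (ler_norm_sum _ _ _) _; apply: ler_sum => f _.
apply: le_trans (ler_norm_sum _ _ _) _; apply: ler_sum => f' _.
rewrite [X in _ - _ * nu X]setIC -mulrBl normrM.
have d : definable ([set b | t b = f] `&` [set b | t' b = f']) by exact: definable_setI.
rewrite [X in _ * X]ger0_norm ?(keisler_ge0 nuK) //.
have [E|/eqP/set0P[b [/= tb t'b]]] :=
    pselect ([set b | t b = f] `&` [set b | t' b = f'] = set0).
  by rewrite E (keisler_set0 nuK) !mulr0.
by rewrite ler_wpM2r ?(keisler_ge0 nuK) // -tb -t'b.
Qed.

Lemma step_int_add (F F' : finType) (t : (J -> M) -> F) (t' : (J -> M) -> F') H H' :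
  definable_map setT t -> definable_map setT t' ->
  step_int (fun b => (t b, t' b)) (fun p => H p.1 + H' p.2) =
  step_int t H + step_int t' H'.
Proof.
move=> dt dt'; rewrite (step_int_pair _ dt dt') (step_int_pair _ dt' dt).
rewrite [X in _ = _ + X]exchange_big /= -big_split /=.
under [RHS]eq_bigr => f _ do rewrite -big_split /=.
rewrite [RHS]pair_bigA /=; apply: eq_bigr => -[f f'] _ /=.
rewrite [X in _ = _ + _ * nu X]setIC -mulrDl; congr (_ * nu _).
by apply/seteqP; split=> b /=; [move=> [-> ->]|move=> [-> ->]].
Qed.

Lemma step_int_ge0 (F : finType) (t : (J -> M) -> F) H :
  definable_map setT t -> (forall f, 0 <= H f) -> 0 <= step_int t H.
Proof.
move=> dt H0; apply: sumr_ge0 => f _; apply: mulr_ge0 => //.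
exact: (keisler_ge0 nuK (dt f)).
Qed.

(** A frequency is an average of indicator functions, so this is the linearity of the
   integral. *)
Lemma step_int_frequency N (D : 'I_N -> set (J -> M)) :
  (forall i, definable (D i)) ->
  step_int (truth D) (fun s => #|[pred i | s i]|%:R / N%:R) = (\sum_i nu (D i)) / N%:R.
Proof.
move=> dD; have dt := definable_map_truth dD.
rewrite /step_int mulr_suml.
transitivity (\sum_s \sum_i nu (D i `&` [set b | truth D b = s]) / N%:R); last first.
  rewrite exchange_big /=; apply: eq_bigr => i _.
  by rewrite -mulr_suml -keisler_partition.
apply: eq_bigr => s _; rewrite -mulr_suml mulrAC; congr (_ / _).
rewrite -sum1_card natr_sum mulr_suml [LHS]big_mkcond /=; apply: eq_bigr => i _.
case: ifPn => /= si.
  rewrite mul1r; congr nu; apply/seteqP; split=> b; last by move=> [].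
  by move=> tb; split=> //; move: si; rewrite -tb inE ffunE => /asboolP.
rewrite -(keisler_set0 nuK); congr nu; apply/seteqP; split=> // b [Db tb].
by move: si; rewrite -tb inE ffunE; move/negP; apply; apply/asboolP.
Qed.

End StepIntegral.

(** * Functions approximated by definable step functions *)

Definition step_approximable {R : realType} L (M : structure L) (A : set M) (J : Type)
    (g : (J -> M) -> R) : Prop :=
  forall e : R, 0 < e -> exists (F : finType) (t : (J -> M) -> F) (H : F -> R),
    definable_map A t /\ forall b, `|g b - H (t b)| <= e.

Lemma tp_eqP L (M : structure L) (A : set M) (J : Type) (b b' : J -> M) :
  (forall D, definable_over A D -> D b -> D b') -> tp A b = tp A b'.
Proof.
move=> H; suff E : sval (tp A b) = sval (tp A b').
  by case: (tp A b) (tp A b') E => [p pP] [p' pP'] /= pp'; subst p'; congr exist.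
apply: funext => phi; apply: propext; split; first by apply: H; exists phi.
have := H _ (definable_not (ex_intro _ phi erefl)) => {}H p'.
by apply: contrapT => p; exact: (H p).
Qed.

Section Descent.
Context {R : realType} (K : Type) {L : language} {M : structure L} {J : finType}.
Hypotheses (satM : saturated K M) (Kn : below K nat).
Variables (A : set M) (g : (J -> M) -> R).
Hypothesis KA : small K A.
Hypothesis gB : forall e : R, 0 < e ->
  exists (B : set M) (F : finType) (t : (J -> M) -> F) (H : F -> R),
    [/\ small K B, definable_map B t & forall b, `|g b - H (t b)| <= e].
Hypothesis (gA : forall b b', tp A b = tp A b' -> g b = g b').

(** If no [A]-definable neighbourhood of [b0] works, then saturation over [A] and the
   parameters of a step function close to [g] gives a realization of [tp A b0] where
   [g] differs from [g b0]. *)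
Lemma descent_local (b0 : J -> M) (e : R) : 0 < e ->
  exists D, [/\ definable_over A D, D b0 & forall b, D b -> `|g b - g b0| <= e].
Proof.
move=> e0; have [|B [F [t [H [KB dt gH]]]]] := gB (e := e / 2); first by rewrite divr_gt0.
pose far := [set b | e / 2 < `|H (t b) - g b0|].
have dfar : definable_over B far.
  exact: (definable_map_preimage (fun f => e / 2 < `|H f - g b0|) dt).
have [[D [dD Db0 Dfar]]|none] := pselect (exists D,
    [/\ definable_over A D, D b0 & forall b, D b -> ~ far b]).
  exists D; split=> // b /Dfar /negP; rewrite -leNgt => Hb.
  rewrite [e]splitr -(subrK (H (t b)) (g b)) -addrA.
  by apply: le_trans (ler_normD _ _) _; exact: lerD.
pose F0 := filter_from [set D | definable_over A D /\ D b0] (fun D => D `&` far).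
have FF : ProperFilter F0.
  apply: filter_from_proper.
    apply: filter_from_filter; first by exists setT; split=> //; exact: definableT.
    move=> D D' [dD Db0] [dD' D'b0]; exists (D `&` D').
      by split=> //; exact: definable_setI.
    by move=> b [[Db D'b] fb]; split.
  move=> D [dD Db0]; apply: contrapT => nD; apply: none; exists D; split=> // b Db fb.
  by apply: nD; exists b.
have KAB : small K (A `|` B) by exact: small_setU.
have [b bP] := realize_filter satM KAB FF.
have bfar : far b.
  apply: bP; first by apply: definable_over_sub dfar; exact: subsetUr.
  by exists setT; [split=> //; exact: definableT|exact: subIsetr].
have : g b = g b0.
  apply/esym/gA/tp_eqP => D dD Db0; apply: bP.
    by apply: definable_over_sub dD; exact: subsetUl.
  by exists D => //; exact: subIsetl.
by move=> E; have := gH b; rewrite E distrC leNgt bfar.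
Qed.

(** The topology of types is generated by [A]-definable sets, so [descent_local] says
   that [g] is continuous as a function of the type of its argument. *)
Lemma descent_continuous (V : set R) : open V ->
  open [set q : stone A J | V (g (realization q))].
Proof.
move=> oV; rewrite openE => q /= Vq.
have /nbhs_ballP[e /= e0 eV] : nbhs (g (realization q)) V by exact: open_nbhs_nbhs.
have e20 : 0 < e / 2 by rewrite divr_gt0.
have [D [dD Dq DV]] := descent_local (realization q) e20.
have : nbhs q (cl D) by apply: open_nbhs_nbhs; split=> //; exact: (cl_open satM KA dD).
apply: filterS => q' Dq'; apply: eV; rewrite /ball /= distrC.
by apply: le_lt_trans (DV _ Dq') _; rewrite ltr_pdivrMr // ltr_pMr // ltr1n.
Qed.

(** Finitely many of the neighbourhoods given by [descent_local] cover the Stone space;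
   on each cell that they generate, take the value of [g] at the centre of one of them
   that contains the cell. *)
Lemma descent : step_approximable A g.
Proof.
move=> e e0; have /choice[E EP] := fun q : stone A J => descent_local (realization q) e0.
have : compact [set: stone A J] by exact: (stone_compact satM KA).
rewrite compact_cover => /(_ _ setT (fun q => cl (E q))) [|q _|F _ TF].
- by move=> q _; have [dE _ _] := EP q; exact: (cl_open satM KA dE).
- by exists q => //; have [] := EP q.
pose H (s : {ffun F -> bool}) : R :=
  if [pick q : F | s q] is Some q then g (realization (val q)) else 0.
exists {ffun F -> bool}, (truth (fun q : F => E (val q))), H; split.
  by apply: definable_map_truth => q; have [] := EP (val q).
move=> b; rewrite /H; case: pickP => [q|/= nE].
  by rewrite ffunE => /asboolP Eb; have [_ _] := EP (val q); apply.
have [q Fq Eq] := TF (tp A b) I.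
have [dE _ _] := EP q.
have := nE (FSetSub Fq); rewrite ffunE /= => /asboolP[].
exact/(cl_tp satM KA b dE).
Qed.

End Descent.

(** * Integrals over the Stone space *)

Section IntegralStep.
Context {R : realType} (K : Type) {L : language} {M : structure L} {J : finType}.
Hypothesis satM : saturated K M.
Context {A : set M} (KA : small K A) {nu : set (J -> M) -> R}.
Hypothesis nuK : keisler_measure nu.
Variable P : probability (borel_stone A J) R.
Hypothesis Pnu : regular_extension nu P.

Lemma measurable_cl D : definable_over A D ->
  measurable (cl D : set (borel_stone A J)).
Proof. by move=> dD; apply: sub_sigma_algebra; exact: (cl_open satM KA dD). Qed.

Lemma probability_cl D : definable_over A D -> P (cl D) = (nu D)%:E.
Proof. by move=> [phi ->]; rewrite (cl_psat satM KA); case: Pnu => _ ->. Qed.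

Lemma integral_step (F : finType) (t : (J -> M) -> F) (H : F -> R) :
  definable_map A t ->
  P.-integrable setT (fun q : borel_stone A J => (H (t (realization (q : stone A J))))%:E) /\
  (\int[P]_(q in [set: borel_stone A J]) (H (t (realization (q : stone A J))))%:E =
   (step_int nu t H)%:E)%E.
Proof.
move=> dt; pose C f : set (borel_stone A J) := cl [set b | t b = f].
have mC f : measurable (C f) by exact: measurable_cl.
have E (q : borel_stone A J) : (H (t (realization (q : stone A J))))%:E =
    (\sum_f (H f)%:E * (\1_(C f) q)%:E)%E.
  rewrite (bigD1 (t (realization (q : stone A J)))) //= big1 ?adde0.
    by rewrite indicE mem_set ?mule1.
  move=> f /eqP nf; rewrite indicE memNset ?mule0 // => Cq; exact: nf (esym Cq).
have iC f : P.-integrable setT (fun q => (H f)%:E * (\1_(C f) q)%:E)%E.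
  by apply: integrableZl => //; exact: integrable_indic.
split; first by under eq_fun do rewrite E; apply: integrable_sum.
under eq_integral do rewrite E.
rewrite integral_sum // /step_int -sumEFin; apply: eq_bigr => f _.
rewrite integralZl //; last exact: integrable_indic.
by rewrite integral_indic // setIT [X in (_ * X)%E](probability_cl (dt f)).
Qed.

(** For an [A]-definable step function close to [g], the claim is a comparison of two
   integrals on the Stone space, by [integral_step]. This step function is then
   compared with any other one by [step_int_close], which does not refer to [A]. *)
Lemma integral_close (g : (J -> M) -> R) :
  (forall V : set R, open V -> open [set q : stone A J | V (g (realization q))]) ->
  step_approximable A g ->
  exists2 r : R, (r%:E = \int[P]_(q in [set: borel_stone A J])
                 (g (realization (q : stone A J)))%:E)%E &
  forall (F : finType) (t : (J -> M) -> F) (H : F -> R) e,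
    definable_map setT t -> (forall b, `|g b - H (t b)| <= e) ->
    `|r - step_int nu t H| <= e.
Proof.
move=> gV gA; have PT : P setT = 1%E by exact: probability_setT.
pose f (q : borel_stone A J) := g (realization (q : stone A J)).
have mf : measurable_fun setT f.
  apply: (measurability _ (measurable_realfun.RGenOInfty.measurableE R)) => _ [_ [x ->] <-].
  by rewrite setTI; apply: sub_sigma_algebra; exact: gV.
have fi : P.-integrable setT (EFin \o f).
  apply: measurable_bounded_integrable => //; first by rewrite [X in (X < _)%E]PT ltry.
  have [F [t [H [_ gH]]]] := gA 1 ltr01.
  exists (1 + \sum_f `|H f|); split; first exact: num_real.
  move=> x /ltW Hx q _ /=; apply: le_trans Hx.
  rewrite /f -(subrK (H (t (realization (q : stone A J)))) (g _)).
  apply: le_trans (ler_normD _ _) _; apply: lerD => //.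
  by rewrite (bigD1 (t (realization (q : stone A J)))) //= lerDl sumr_ge0.
exists (\int[P]_(q in setT) f q); first by rewrite fineK //; exact: integrable_fin_num.
have stepA F t H e : definable_map A t -> (forall b, `|g b - H (t b)| <= e) ->
    `|\int[P]_(q in setT) f q - @step_int R L M J nu F t H| <= e.
  move=> dt gH; have [iH EH] := integral_step H dt.
  have -> : step_int nu t H = \int[P]_(q in setT) H (t (realization (q : stone A J))).
    by rewrite /Rintegral EH.
  rewrite -RintegralB //.
  have iB : P.-integrable setT (EFin \o (fun q => f q - H (t (realization (q : stone A J))))).
    by have := integrableB measurableT fi iH.
  apply: le_trans (le_normr_Rintegral _ _) _ => //.
  have -> : e = \int[P]_(q in setT) e.
    by rewrite Rintegral_cst // [X in fine X]PT mulr1.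
  apply: le_Rintegral => //; first exact: integrable_norm.
    by apply: finite_measure_integrable_cst.
  by move=> q _; exact: gH.
move=> F t H e dt gH; apply/ler_addgt0Pr => d d0.
have [F' [t' [H' [dt' gH']]]] := gA (d / 2) (divr_gt0 d0 (ltr0n _ 2)).
have dt'T : definable_map setT t' by move=> x; exact: definableW (dt' x).
have HH' b : `|H' (t' b) - H (t b)| <= d / 2 + e.
  by apply: le_trans (ler_distD (g b) _ _) _; apply: lerD; rewrite // distrC.
apply: le_trans (ler_distD (step_int nu t' H') _ _) _.
rewrite (_ : e + d = d / 2 + (d / 2 + e)); last by rewrite addrA -splitr addrC.
by apply: lerD; [exact: stepA|exact: step_int_close].
Qed.

End IntegralStep.

(** * The tensor product *)

Section Partition.
Context {L : language} {M : structure L} {I J : finType} {m : nat}.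

(** Moving the variables [y], respectively [x], of [phi (xy; z)] to the parameters makes
   the approximations uniform in them. *)
Definition split_left (phi : formula L (I + J + 'I_m)%type) :
    formula L (I + 'I_(#|J| + m))%type :=
  rename (fun z => match z with
                   | inl (inl x) => inl x
                   | inl (inr y) => inr (lshift m (enum_rank y))
                   | inr i => inr (rshift #|J| i)
                   end) phi.

Definition split_right (phi : formula L (I + J + 'I_m)%type) :
    formula L (J + 'I_(#|I| + m))%type :=
  rename (fun z => match z with
                   | inl (inl x) => inr (lshift m (enum_rank x))
                   | inl (inr y) => inl y
                   | inr i => inr (rshift #|I| i)
                   end) phi.

Definition params (V : finType) (b : V -> M) (d : 'I_m -> M) : 'I_(#|V| + m) -> M :=
  fun i => match fintype.split i with inl j => b (enum_val j) | inr k => d k end.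

Lemma params_lshift (V : finType) (b : V -> M) (d : 'I_m -> M) y :
  params b d (lshift m (enum_rank y)) = b y.
Proof. by rewrite /params (unsplitK (inl _)) enum_rankK. Qed.

Lemma params_rshift (V : finType) (b : V -> M) (d : 'I_m -> M) i :
  params b d (rshift #|V| i) = d i.
Proof. by rewrite /params (unsplitK (inr _)). Qed.

Lemma inst_split_left phi b d :
  inst (split_left phi) (params b d) = [set a | inst phi d (a +++ b)].
Proof.
rewrite /inst /split_left /split_right; set h := (X in rename X _).
have E (a : I -> M) : (a +++ params b d) \o h = (a +++ b) +++ d.
  by apply: funext => -[[x|y]|i] //=; rewrite ?params_lshift ?params_rshift.
by apply/seteqP; split=> a /=; rewrite sat_rename E.
Qed.

Lemma inst_split_right phi a d :
  inst (split_right phi) (params a d) = [set b | inst phi d (a +++ b)].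
Proof.
rewrite /inst /split_left /split_right; set h := (X in rename X _).
have E (b : J -> M) : (b +++ params a d) \o h = (a +++ b) +++ d.
  by apply: funext => -[[x|y]|i] //=; rewrite ?params_lshift ?params_rshift.
by apply/seteqP; split=> b /=; rewrite sat_rename E.
Qed.

End Partition.

Definition finitely_approximated {R : realType} L (M : structure L) (I : Type)
    (mu : set (I -> M) -> R) : Prop :=
  forall m (phi : formula L (I + 'I_m)%type) (e : R), 0 < e ->
    exists N (a : 'I_N -> I -> M), is_approximation phi e mu a.

Lemma Av_sum {R : realType} L (M : structure L) (I : Type) N (a : 'I_N -> I -> M) D :
  Av a D = (\sum_i (`[< D (a i) >])%:R) / N%:R :> R.
Proof.
rewrite /Av -sum1_card natr_sum [X in X / _ = _]big_mkcond /=; congr (_ / _).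
by apply: eq_bigr => i _; rewrite inE; case: asboolP.
Qed.

Lemma small_finite K U (F : finType) (f : F -> U) : below K nat -> small K (range f).
Proof.
move=> Kn; apply: small_range; apply: below_embeds Kn.
by exists pickle; exact: (pcan_inj pickleK).
Qed.

Section Tensor.
Context {R : realType} {K : Type} {L : language} {M : structure L} {I J : finType}.
Hypotheses (satM : saturated K M) (Kn : below K nat)
  (Kf : below K (fun_symbol L)) (Kr : below K (rel_symbol L)).

Definition fiber (D : set (I + J -> M)) (b : J -> M) : set (I -> M) := [set a | D (a +++ b)].

Section FiberMeasure.
Variable mu : set (I -> M) -> R.
Hypothesis mua : finitely_approximated mu.

Lemma Av_frequency N (a : 'I_N -> I -> M) D b :
  Av a (fiber D b) =
  #|[pred i | truth (fun i => [set b | D (a i +++ b)]) b i]|%:R / N%:R :> R.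
Proof. by rewrite /Av; congr (_%:R / _); apply: eq_card => i; rewrite !inE ffunE. Qed.

Lemma fiber_approximation D (e : R) : definable D -> 0 < e ->
  exists N (a : 'I_N -> I -> M), forall b, `|Av a (fiber D b) - mu (fiber D b)| <= e.
Proof.
move=> /definableP[m [phi [d [_ ->]]]] e0.
have [N [a aP]] := mua (split_left phi) e0.
by exists N, a => b; have := aP (params b d); rewrite inst_split_left.
Qed.

(** The frequency of the fibre in an approximating tuple is a step function that is
   definable over the parameters of [D] and the entries of the tuple. *)
Lemma fiber_steps A D (e : R) : small K A -> definable_over A D -> 0 < e ->
  exists (B : set M) (F : finType) (t : (J -> M) -> F) (H : F -> R),
    [/\ small K B, definable_map B t, forall f, 0 <= H f &
        forall b, `|mu (fiber D b) - H (t b)| <= e].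
Proof.
move=> KA dD e0; have [N [a aP]] := fiber_approximation (definableW dD) e0.
exists (A `|` range (fun z : 'I_N * I => a z.1 z.2)), {ffun 'I_N -> bool},
  (truth (fun i => [set b | D (a i +++ b)])),
  (fun s : {ffun 'I_N -> bool} => #|[pred i | s i]|%:R / N%:R); split.
- by apply: small_setU => //; exact: small_finite.
- apply: definable_map_truth => i; apply: definable_fiberr dD; first exact: subsetUl.
  by move=> x; right; exists (i, x).
- by move=> s; rewrite divr_ge0.
- by move=> b; rewrite -Av_frequency distrC.
Qed.

(** The fibre at [b] is an instance of a formula at [b] and the parameters of [D], and
   the type of this tuple over [A] is determined by that of [b]. *)
Lemma fiber_invariant A D b b' : invariant_over A mu -> definable_over A D ->
  tp A b = tp A b' -> mu (fiber D b) = mu (fiber D b').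
Proof.
move=> inv /definableP[m [phi [d [dA ->]]]] bb'.
rewrite /fiber -!inst_split_left; apply: inv; apply: tp_eqP => E dE.
pose s (i : 'I_(#|J| + m)) : J + sig A :=
  match fintype.split i with
  | inl j => inl (enum_val j)
  | inr k => inr (exist _ (d k) (dA k))
  end.
have sE (c : J -> M) : (c +++ @sval M A) \o s = params c d.
  by apply: funext => i; rewrite /params /s /=; case: (fintype.split i).
have [phi' phi'E] := definable_subst s (@subset_refl _ A) dE.
have key c : E (params c d) <-> sval (tp A c) phi'.
  by rewrite -sE; have := congr1 (@^~ c) phi'E => /= ->.
by move=> /key; rewrite bb' => /key.
Qed.

End FiberMeasure.

Variables (mu : set (I -> M) -> R) (nu : set (J -> M) -> R).
Hypotheses (muS : generically_stable K mu) (mua : finitely_approximated mu).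
Hypothesis nuK : keisler_measure nu.

(** The integral over any admissible model is computed by step functions, which do not
   depend on the model; and there is an admissible model, namely one that contains the
   parameters of [D] and a model over which [mu] is invariant. *)
Lemma tensor_close D (F : finType) (t : (J -> M) -> F) (H : F -> R) e :
  definable D -> definable_map setT t ->
  (forall b, `|mu (fiber D b) - H (t b)| <= e) ->
  `|tensor K mu nu D - step_int nu t H| <= e.
Proof.
move=> dD dt muH.
have close A (P : probability (borel_stone A J) R) : small K A -> invariant_over A mu ->
    definable_over A D -> regular_extension nu P ->
    exists2 r : R, (r%:E = \int[P]_(q in [set: borel_stone A J])
                 (mu (fiber D (realization (q : stone A J))))%:E)%E &
      `|r - step_int nu t H| <= e.
  move=> KA inv dDA Pnu.
  have gA b b' := @fiber_invariant mu A D b b' inv dDA.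
  have gB (d : R) : 0 < d -> exists (B : set M) (F : finType) (t : (J -> M) -> F) (H : F -> R),
    [/\ small K B, definable_map B t & forall b, `|mu (fiber D b) - H (t b)| <= d].
    by move=> d0; have [B [F' [t' [H' [? ? ? ?]]]]] := fiber_steps mua KA dDA d0;
      exists B, F', t', H'.
  have gV V := @descent_continuous _ _ _ _ _ satM Kn _ _ KA gB gA V.
  have gS := descent satM Kn KA gB gA.
  have [r rE rP] := integral_close satM KA nuK Pnu gV gS.
  by exists r => //; exact: rP.
have [r0 r0P] : exists r0 : R,
    [set r | exists (A : set M) (P : probability (borel_stone A J) R),
    [/\ small_model K A, invariant_over A mu, definable_over A D,
        regular_extension nu P &
        r%:E = (\int[P]_(q in [set: borel_stone A J])
                  (mu [set a | D (a +++ realization (q : stone A J))])%:E)%E]] r0.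
  have [_ [A0 [[KA0 _] [inv0 _] _]]] := muS.
  have [m [phi [d [_ Dd]]]] := definableP dD.
  have [A A0A modA] := small_model_containing Kn Kf Kr
    (small_setU Kn KA0 (small_finite d Kn)).
  have KA := modA.1.
  have inv : invariant_over A mu.
    move=> m' psi b b' bb'; apply: inv0; apply: tp_eqP => E dE Eb.
    have {dE}[chi EE] : definable_over A E.
      by apply: definable_over_sub dE => x Ax; apply: A0A; left.
    have : sval (tp A b) chi by move: Eb; rewrite EE.
    by rewrite bb' EE.
  have dDA : definable_over A D.
    by rewrite Dd; apply: definable_inst => i; apply: A0A; right; exists i.
  have [P PP] := regular_extension_exists satM KA nuK.
  by have [r rE _] := close A P KA inv dDA PP; exists r, A, P; split.
have := xgetPex 0 (ex_intro _ r0 r0P).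
rewrite -/(tensor K mu nu D) => -[A [P [[KA _] inv dDA PP rE]]].
have [r rE' rP] := close A P KA inv dDA PP.
suff -> : tensor K mu nu D = r by [].
by apply: EFin_inj; rewrite rE rE'.
Qed.

(** Step functions for the fibres of [D] and of [D'] add up to one for the fibres of
   their union. The tuples that approximate [mu] for the three sets are unrelated, so
   that additivity is not visible on averages. *)
Lemma tensor_keisler : keisler_measure (tensor K mu nu).
Proof.
have steps D (e : R) : definable D -> 0 < e ->
  exists (F : finType) (t : (J -> M) -> F) (H : F -> R),
    [/\ definable_map setT t, forall f, 0 <= H f &
        forall b, `|mu (fiber D b) - H (t b)| <= e].
  move=> dD e0; have [m [phi [d [_ Dd]]]] := definableP dD.
  have [//||B [F [t [H [_ dt H0 HP]]]]] := @fiber_steps mu mua (range d) D e _ _ e0.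
  - exact: small_finite.
  - by rewrite Dd; apply: definable_inst => i; exists i.
  by exists F, t, H; split=> // f; exact: definableW (dt f).
have muK : keisler_measure mu by case: muS.
split.
- move=> D dD; apply/ler_addgt0Pl => e e0.
  have [F [t [H [dt H0 HP]]]] := steps D e dD e0.
  have := tensor_close dD dt HP; have := step_int_ge0 nuK dt H0.
  by rewrite ler_norml; lra.
- have dt : definable_map setT (fun _ : J -> M => tt).
    by move=> []; apply: (@definable_cst _ _ _ _ (tt = tt)).
  have := @tensor_close setT _ _ (fun=> 1) 0 definableT dt.
  rewrite (_ : step_int nu _ _ = 1); last first.
    rewrite /step_int (bigD1 tt) //= big1 => [|[]//]; rewrite addr0 mul1r.
    by rewrite -[RHS](keisler_setT nuK); congr nu; apply/seteqP; split.
  rewrite normr_le0 subr_eq0 => H; apply/eqP/H => b.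
  by rewrite (_ : fiber setT b = setT) ?(keisler_setT muK) ?subrr ?normr0.
- move=> D D' dD dD' DD'.
  apply/eqP; rewrite -subr_eq0 -normr_le0; apply/ler_addgt0Pl => e e0.
  have e40 : 0 < e / 4 by rewrite divr_gt0.
  have [F [t [H [dt _ HP]]]] := steps D (e / 4) dD e40.
  have [F' [t' [H' [dt' _ HP']]]] := steps D' (e / 4) dD' e40.
  have := tensor_close dD dt HP; have := tensor_close dD' dt' HP'.
  have := @tensor_close (D `|` D') _ _ (fun p => H p.1 + H' p.2) (e / 2)
    (definable_setU dD dD') (definable_map_pair dt dt').
  rewrite (step_int_add nuK) // => /(_ _)/=.
  have HH b : `|mu (fiber (D `|` D') b) - (H (t b) + H' (t' b))| <= e / 2.
    rewrite (_ : fiber (D `|` D') b = fiber D b `|` fiber D' b) //.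
    have dfib E : definable E -> definable (fiber E b).
      by move=> dE; exact: definable_fiberl dE.
    rewrite (keisler_setU muK) //; first last.
    + by apply/seteqP; split=> // a [Da D'a]; have : (D `&` D') (a +++ b) by []; rewrite DD'.
    + exact: dfib.
    + exact: dfib.
    have := HP b; have := HP' b; rewrite !ler_norml; lra.
  move=> /(_ HH); rewrite !ler_norml; lra.
Qed.

(** Integrating the average over [a] against [nu] gives the average over [i] of the
   [nu]-measure of the fibre at [a i]; each of these is approximated by [b]. *)
Lemma tensor_Av N N' (a : 'I_N -> I -> M) (b : 'I_N' -> J -> M) D e e' :
  definable D ->
  (forall y, `|Av a (fiber D y) - mu (fiber D y)| <= e) ->
  (forall x, `|Av b [set y | D (x +++ y)] - nu [set y | D (x +++ y)]| <= e') ->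
  `|(\sum_i Av b [set y | D (a i +++ y)]) / N%:R - tensor K mu nu D| <= e + e'.
Proof.
move=> dD aP bP.
have dDi i : definable [set y | D (a i +++ y)] by exact: definable_fiberr dD.
have t0 b0 := Av_frequency a D b0.
have := @tensor_close D _ _ (fun s : {ffun 'I_N -> bool} => #|[pred i | s i]|%:R / N%:R) e dD
  (definable_map_truth dDi).
rewrite (step_int_frequency nuK) // => /(_ _)/= H.
have {}H : `|tensor K mu nu D - (\sum_i nu [set y | D (a i +++ y)]) / N%:R| <= e.
  by apply: H => y; rewrite -t0 distrC.
rewrite distrC; apply: le_trans (ler_distD ((\sum_i nu [set y | D (a i +++ y)]) / N%:R) _ _) _.
apply: lerD => //; rewrite distrC -mulrBl -sumrB normrM normfV normr_nat.
have [N0|N0] := posnP N.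
  by rewrite [X in X%:R]N0 invr0 mulr0; apply: le_trans (bP point).
rewrite ler_pdivrMr ?ltr0n //.
apply: le_trans (ler_norm_sum _ _ _) _.
rewrite -[X in _ * X%:R](card_ord N) -sum1_card natr_sum mulr_sumr.
by apply: ler_sum => i _; rewrite mulr1.
Qed.

End Tensor.

(** * Codes of generically stable measures *)

Arguments block {R L M n I} a {m} phi k _ _.

(** The average of [phi (x, b)] over a tuple from [A] depends only on the type of [b]
   over [A], and continuously; a formula of positive measure has a positive average
   over a good approximation, hence is satisfied by one of its entries. *)
Lemma keisler_gs (R : realType) (K : Type) (L : language) (M : structure L) (I : finType)
    (mu : set (I -> M) -> R) (A : set M) :
  saturated K M -> below K nat -> keisler_measure mu -> small_model K A ->
  (forall m (phi : formula L (I + 'I_m)%type) (e : R), 0 < e ->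
     exists N (a : 'I_N -> I -> M), (forall i x, A (a i x)) /\ is_approximation phi e mu a) ->
  generically_stable K mu.
Proof.
move=> satM Kn muK modA approx; have KA := modA.1.
have dphi m (phi : formula L (I + 'I_m)%type) a : (forall x, A (a x)) ->
    definable_over A [set b : 'I_m -> M | inst phi b a].
  move=> aA; have := definable_fiberr (@subset_refl _ A) aA
    (definable_sat A phi (idfun : I + 'I_m -> I + 'I_m)).
  by [].
have inv : invariant_over A mu.
  move=> m phi b b' bb'; apply/eqP; rewrite -subr_eq0 -normr_le0.
  apply/ler_addgt0Pl => e e0; rewrite addr0.
  have [N [a [aA aP]]] := approx m phi (e / 2) (divr_gt0 e0 (ltr0n _ 2)).
  have E : Av a (inst phi b) = Av a (inst phi b') :> R.
    rewrite !Av_sum; congr (_ / _); apply: eq_bigr => i _; congr (nat_of_bool _)%:R.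
    have [psi psiE] := dphi m phi (a i) (aA i).
    have key c : inst phi c (a i) <-> sval (tp A c) psi.
      by have := congr1 (@^~ c) psiE => /= ->.
    by apply/asboolP/asboolP => /key; [rewrite bb'|rewrite -bb'] => /key.
  rewrite [e]splitr; apply: le_trans (ler_distD (Av a (inst phi b)) _ _) _.
  by apply: lerD; [rewrite distrC|rewrite E].
split=> //; exists A; split=> //.
- split=> // m phi; apply/continuousP => V oV.
  apply: (@descent_continuous R K L M _ satM Kn A (fun b => mu (inst phi b)) KA) => //.
    move=> e e0; have [N [a [aA aP]]] := approx m phi e e0.
    exists A, {ffun 'I_N -> bool}, (truth (fun i => [set b | inst phi b (a i)])).
    exists (fun s : {ffun 'I_N -> bool} => #|[pred i | s i]|%:R / N%:R); split=> //.
      by apply: definable_map_truth => i; exact: dphi.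
    move=> b; rewrite distrC; have := aP b; rewrite /Av.
    by congr (`|_%:R / _ - _| <= _); apply: eq_card => i; rewrite !inE ffunE.
  by move=> b b'; exact: inv.
- move=> D /definableP[m [phi [d [_ ->]]]] mu0.
  have [N [a [aA aP]]] := approx m phi (mu (inst phi d) / 2) (divr_gt0 mu0 (ltr0n _ 2)).
  have [[i Di]|nD] := pselect (exists i, inst phi d (a i)); first by exists (a i).
  have := aP d; rewrite Av_sum big1 ?mul0r => [|i _]; last first.
    by case: asboolP => // Di; case: nD; exists i.
  by rewrite ler_norml; lra.
Qed.

Section Codes.
Context {R : realType} {K : Type} {L : language} {M : structure L}
  {n : forall (I : finType) m, formula L (I + 'I_m)%type -> R -> nat}.
Hypotheses (satM : saturated K M) (Kn : below K nat)
  (Kf : below K (fun_symbol L)) (Kr : below K (rel_symbol L)).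
Hypothesis nP : approximation_numbers K (M := M) n.

Lemma prec_gt0 k : 0 < prec k :> R.
Proof. by rewrite /prec invr_gt0 ltr0n. Qed.

Lemma prec_le k k' : (k <= k')%N -> prec k' <= prec k :> R.
Proof. by move=> kk'; rewrite /prec lef_pV2 ?posrE ?ltr0n // ler_nat. Qed.

Lemma prec_small (c e : R) : 0 <= c -> 0 < e -> exists k, c * prec k <= e.
Proof.
move=> c0 e0; have [k ck] : exists k : nat, c / e <= k.+1%:R.
  by exists (Num.truncn (c / e)); exact/ltW/truncnS_gt.
exists k; rewrite /prec -ler_pdivlMr ?invr_gt0 ?ltr0n // invrK mulrC -ler_pdivrMr //.
Qed.

Lemma eq0_prec (c x : R) : 0 <= c -> (forall k, `|x| <= c * prec k) -> x = 0.
Proof.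
move=> c0 xP; apply/eqP; rewrite -normr_le0; apply/ler_addgt0Pl => e e0.
by have [k ke] := prec_small c0 e0; rewrite addr0; exact: le_trans (xP k) ke.
Qed.

Section OneVariable.
Context {I : finType}.
Local Notation code := (code_index n I -> M).

Lemma n_gt0 m (phi : formula L (I + 'I_m)%type) k : (0 < n phi (prec k))%N.
Proof. exact: (nP phi (prec_gt0 k)).1. Qed.

Lemma Av_setT m (phi : formula L (I + 'I_m)%type) (a : code) k :
  Av (block a phi k) setT = 1 :> R.
Proof.
rewrite Av_sum (eq_bigr (fun=> 1)) => [|i _]; last by case: asboolP => // -[].
by rewrite sumr_const card_ord divff // pnatr_eq0 -lt0n n_gt0.
Qed.

Lemma Av_ge0 N (a : 'I_N -> I -> M) D : 0 <= Av a D :> R.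
Proof. by rewrite /Av divr_ge0. Qed.

Lemma inst_disj m1 m2 (phi1 : formula L (I + 'I_m1)%type)
    (phi2 : formula L (I + 'I_m2)%type) (b1 : 'I_m1 -> M) (b2 : 'I_m2 -> M) :
  exists b, inst (disj phi1 phi2) b = inst phi1 b1 `|` inst phi2 b2.
Proof.
exists (fun i => match fintype.split i with inl i => b1 i | inr i => b2 i end).
set b := (X in inst _ X).
have E1 (x : I -> M) : (x +++ b) \o (inl +++ (inr \o lshift m2)) = x +++ b1.
  by apply: funext => -[//|i] /=; rewrite /b (unsplitK (inl _)).
have E2 (x : I -> M) : (x +++ b) \o (inl +++ (inr \o @rshift m1 m2)) = x +++ b2.
  by apply: funext => -[//|i] /=; rewrite /b (unsplitK (inr _)).
by apply/seteqP; split=> x; rewrite /inst /disj /= !sat_rename E1 E2.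
Qed.

Lemma cvg_prec (u : nat -> R) l c : 0 <= c -> (forall k, `|u k - l| <= c * prec k) ->
  u @ \oo --> l.
Proof.
move=> c0 ul; apply/cvgrPdist_le => e e0; have [k ke] := prec_small c0 e0.
exists k => // j /= kj; rewrite distrC; apply: le_trans (ul j) _.
by apply: le_trans ke; rewrite ler_wpM2l // prec_le.
Qed.

Lemma cauchy_prec (u : nat -> R) c : 0 <= c ->
  (forall k k1 k2, (k <= k1)%N -> (k <= k2)%N -> `|u k1 - u k2| <= c * prec k) ->
  cvg (u @ \oo).
Proof.
move=> c0 uc; apply/cauchy_cvgP; apply: cauchy_exP => e e0.
have [k ke] := prec_small c0 (divr_gt0 e0 (ltr0n R 2)).
exists (u k); exists k => // k' /= kk'.
rewrite /ball /=; apply: le_lt_trans (uc k k k' (leqnn k) kk') _.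
by apply: le_lt_trans ke _; rewrite ltr_pdivrMr // ltr_pMr // ltr1n.
Qed.

Lemma limit_prec (u : nat -> R) l c :
  (forall k k1 k2, (k <= k1)%N -> (k <= k2)%N -> `|u k1 - u k2| <= c * prec k) ->
  u @ \oo --> l -> forall k, `|u k - l| <= c * prec k.
Proof.
move=> uc ul k; apply/ler_addgt0Pl => e e0.
move/cvgrPdist_le : ul => /(_ e e0)[j _ ju].
apply: le_trans (ler_distD (u (maxn j k)) _ _) _; rewrite addrC; apply: lerD.
  by rewrite distrC; apply: ju; rewrite /= leq_maxl.
by apply: uc => //; rewrite leq_maxr.
Qed.

Lemma code_approximation (a : code) mu m (phi : formula L (I + 'I_m)%type) k :
  code_set a -> measure_of_code a mu ->
  is_approximation phi (2 * prec k) mu (block a phi k).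
Proof.
move=> [a1 _] amu b; apply: (limit_prec (u := fun k => Av (block a phi k) (inst phi b))) => //.
by move=> k0 k1 k2; exact: a1.
Qed.

(** The limits of averages are additive by the second condition on codes, and the limit
   is 1 for the full set. It follows that the limit depends only on the set that a
   formula defines, so that it does give a measure. *)
Lemma code_measure (a : code) : code_set a ->
  exists2 mu : set (I -> M) -> R, keisler_measure mu & measure_of_code a mu.
Proof.
move=> [a1 a2].
pose lm m (phi : formula L (I + 'I_m)%type) b : R :=
  lim ((fun k => Av (block a phi k) (inst phi b) : R) @ \oo).
have lmP m (phi : formula L (I + 'I_m)%type) b :
    (fun k => Av (block a phi k) (inst phi b) : R) @ \oo --> lm m phi b.
  suff : cvg ((fun k => Av (block a phi k) (inst phi b) : R) @ \oo) by [].
  by apply: (@cauchy_prec _ 2) => // k k1 k2; exact: a1.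
have lmk m (phi : formula L (I + 'I_m)%type) b k :
    `|Av (block a phi k) (inst phi b) - lm m phi b| <= 2 * prec k.
  apply: (limit_prec (u := fun k => Av (block a phi k) (inst phi b))) => //.
  by move=> k0 k1 k2; exact: a1.
have lm_disj m1 m2 (phi1 : formula L (I + 'I_m1)%type) (phi2 : formula L (I + 'I_m2)%type)
    b1 b2 b : inst phi1 b1 `&` inst phi2 b2 = set0 ->
    inst (disj phi1 phi2) b = inst phi1 b1 `|` inst phi2 b2 ->
    lm _ (disj phi1 phi2) b = lm _ phi1 b1 + lm _ phi2 b2.
  move=> dis Eb; apply/eqP; rewrite -subr_eq0; apply/eqP/(@eq0_prec 9) => // k.
  have := lmk _ (disj phi1 phi2) b k; have := lmk _ phi1 b1 k; have := lmk _ phi2 b2 k.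
  have := a2 _ _ phi1 phi2 k b1 b2 dis; rewrite Eb !ler_norml; lra.
have lm_setT m (phi : formula L (I + 'I_m)%type) b : inst phi b = setT -> lm _ phi b = 1.
  move=> E; apply/eqP; rewrite -subr_eq0; apply/eqP/(@eq0_prec 2) => // k.
  by have := lmk _ phi b k; rewrite E Av_setT distrC.
have lm_ext m1 m2 (phi1 : formula L (I + 'I_m1)%type) (phi2 : formula L (I + 'I_m2)%type)
    b1 b2 : inst phi1 b1 = inst phi2 b2 -> lm _ phi1 b1 = lm _ phi2 b2.
  (* both formulas have the negation of [phi1] as a complement *)
  move=> E; have Ec : inst (fNot phi1) b1 = ~` inst phi1 b1 by [].
  have [c1 c1E] := inst_disj phi1 (fNot phi1) b1 b1.
  have [c2 c2E] := inst_disj phi2 (fNot phi1) b2 b1.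
  have H1 : lm _ (disj phi1 (fNot phi1)) c1 = lm _ phi1 b1 + lm _ (fNot phi1) b1.
    by apply: lm_disj => //; rewrite Ec setICr.
  have H2 : lm _ (disj phi2 (fNot phi1)) c2 = lm _ phi2 b2 + lm _ (fNot phi1) b1.
    by apply: lm_disj => //; rewrite -E Ec setICr.
  apply: (addIr (lm _ (fNot phi1) b1)); rewrite -H1 -H2 !lm_setT //.
    by rewrite c2E Ec -E setUCr.
  by rewrite c1E Ec setUCr.
pose mu D : R := xget 0 [set r | exists m (phi : formula L (I + 'I_m)%type) b,
  D = inst phi b /\ r = lm _ phi b].
have muE m (phi : formula L (I + 'I_m)%type) b : mu (inst phi b) = lm _ phi b.
  have : exists r, [set r | exists m' (psi : formula L (I + 'I_m')%type) b',
      inst phi b = inst psi b' /\ r = lm _ psi b'] r by exists (lm _ phi b), m, phi, b.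
  by move=> /(xgetPex 0)[m' [psi [b' [/lm_ext ->]]]].
exists mu; last by move=> m phi b; rewrite muE; exact: lmP.
split.
- move=> D /definableP[m [phi [b [_ ->]]]]; rewrite muE.
  apply/ler_addgt0Pl => e e0.
  have [k ke] := prec_small (ler0n R 2) e0.
  have := lmk _ phi b k; have := Av_ge0 (block a phi k) (inst phi b).
  by rewrite ler_norml; lra.
- have /definableP[m [phi [b [_ E]]]] := @definableT L M setT I.
  by rewrite E muE; exact: lm_setT.
- move=> D1 D2 /definableP[m1 [phi1 [b1 [_ ->]]]] /definableP[m2 [phi2 [b2 [_ ->]]]] dis.
  have [b bE] := inst_disj phi1 phi2 b1 b2.
  by rewrite -bE !muE; exact: lm_disj.
Qed.

End OneVariable.
End Codes.

Section MonsterCodes.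
Context {R : realType} {K : Type} {L : language} {M : structure L}
  {n : forall (I : finType) m, formula L (I + 'I_m)%type -> R -> nat}.
Hypotheses (satM : saturated K M) (Kn : below K nat)
  (Kf : below K (fun_symbol L)) (Kr : below K (rel_symbol L)).
Hypothesis nP : approximation_numbers K (M := M) n.

Lemma gs_approximated (I : finType) (mu : set (I -> M) -> R) :
  generically_stable K mu -> finitely_approximated mu.
Proof.
move=> muS m phi e e0; have [_ /(_ mu muS)[a aP]] := nP phi e0.
by exists (n phi e), a.
Qed.

Lemma below_code_index (I : finType) : below K (code_index n I).
Proof.
have Kv : below K void by apply: below_embeds Kn; exists (of_void nat) => -[].
apply: below_embeds (below_code Kn Kf Kr Kv).
exists (fun c : code_index n I => GenTree.Node 0 [:: GenTree.Leaf (inl (ci_arity c));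
  formula_code (fun z => GenTree.Leaf (inl (pickle z))) (ci_formula c);
  GenTree.Leaf (inl (ci_prec c)); GenTree.Leaf (inl (nat_of_ord (ci_pos c)));
  GenTree.Leaf (inl (pickle (ci_var c)))]).
move=> [m phi k i x] [m' phi' k' i' x'] /= [mm]; subst m'.
move=> /formula_code_inj E kk; subst k'.
have {}E : phi = phi' by apply: E => z z' [] /(pcan_inj pickleK).
by subst phi' => /ord_inj -> /(pcan_inj pickleK) ->.
Qed.

Lemma small_code (I : finType) (a : code_index n I -> M) : small K (range a).
Proof. exact/small_range/below_code_index. Qed.

(** A choice of approximations at precision [1 / k] for each formula satisfies the
   conditions on codes, by the triangle inequality and the additivity of [mu]. *)
Lemma gs_code (I : finType) (mu : set (I -> M) -> R) : generically_stable K mu ->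
  exists2 a : code_index n I -> M, code_set a & measure_of_code a mu.
Proof.
move=> muS; have muK : keisler_measure mu by case: muS.
have approx m (phi : formula L (I + 'I_m)%type) k :
    {a : 'I_(n phi (prec k)) -> I -> M | is_approximation phi (prec k) mu a}.
  by apply/cid; have [_ /(_ mu muS)] := nP phi (prec_gt0 k).
pose a (c : code_index n I) : M :=
  sval (approx _ (ci_formula c) (ci_prec c)) (ci_pos c) (ci_var c).
have aP m (phi : formula L (I + 'I_m)%type) k :
    is_approximation phi (prec k) mu (block a phi k).
  exact: (svalP (approx m phi k)).
exists a; last first.
  move=> m phi b; apply: (@cvg_prec _ _ _ 1) => // k; rewrite mul1r; exact: aP.
split.
- move=> m phi k k1 k2 b k1k k2k.
  apply: le_trans (ler_distD (mu (inst phi b)) _ _) _; rewrite mulr_natl mulr2n.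
  apply: lerD; last rewrite distrC; apply: le_trans (aP _ _ _ _) _; exact: prec_le.
- move=> m1 m2 phi1 phi2 k b1 b2 dis.
  have [b bE] := inst_disj phi1 phi2 b1 b2.
  have dphi m (phi : formula L (I + 'I_m)%type) c : definable (inst phi c).
    exact: definable_inst.
  have := aP _ (disj phi1 phi2) k b; have := aP _ phi1 k b1; have := aP _ phi2 k b2.
  rewrite bE (keisler_setU muK) // !ler_norml; lra.
Qed.

(** By [keisler_gs], for a small model that contains all the entries of [a]. *)
Lemma code_gs (I : finType) (a : code_index n I -> M) : code_set a ->
  exists2 mu : set (I -> M) -> R, generically_stable K mu & measure_of_code a mu.
Proof.
move=> aX; have [mu muK amu] := code_measure nP aX.
exists mu => //.
have [A aA modA] := small_model_containing Kn Kf Kr (small_code a).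
apply: (keisler_gs satM Kn muK modA) => m phi e e0.
have [k ke] := prec_small (ler0n R 2) e0.
exists _, (block a phi k); split=> [i x|b]; first by apply: aA; exists (CodeIndex i x).
by apply: le_trans ke; exact: code_approximation.
Qed.

Section TwoVariables.
Context {I J : finType}.

Definition Av2 N N' (a : 'I_N -> I -> M) (b : 'I_N' -> J -> M) (D : set (I + J -> M)) : R :=
  (\sum_i Av b [set y | D (a i +++ y)]) / N%:R.

Definition code_Av2 (a : code_index n I -> M) (b : code_index n J -> M) m
    (phi : formula L (I + J + 'I_m)%type) k (d : 'I_m -> M) : R :=
  Av2 (block a (split_left phi) k) (block b (split_right phi) k) (inst phi d).

Lemma tensor_code_Av2 a b mu nu m (phi : formula L (I + J + 'I_m)%type) k d :
  code_set a -> code_set b -> measure_of_code a mu -> measure_of_code b nu ->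
  generically_stable K mu -> generically_stable K nu ->
  `|code_Av2 a b phi k d - tensor K mu nu (inst phi d)| <= 4 * prec k.
Proof.
move=> aX bX amu bnu muS nuS.
have nuK : keisler_measure nu by case: nuS.
rewrite (_ : 4 * prec k = 2 * prec k + 2 * prec k :> R); last by rewrite -mulrDl -natrD.
apply: (tensor_Av satM Kn Kf Kr muS (gs_approximated muS) nuK).
- exact: definable_inst.
- by move=> y; rewrite /fiber -inst_split_left; exact: code_approximation.
- by move=> x; rewrite -inst_split_right; exact: code_approximation.
Qed.

Lemma Av2_Av N N' (a : 'I_N -> I -> M) (b : 'I_N' -> J -> M) :
  exists N'' (c : 'I_N'' -> I + J -> M), (forall z, exists i j, c z = a i +++ b j) /\
    forall D, Av c D = Av2 a b D.
Proof.
have E : #|{: 'I_N * 'I_N'}| = (N * N')%N by rewrite card_prod !card_ord.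
exists #|{: 'I_N * 'I_N'}|, (fun z => a (enum_val z).1 +++ b (enum_val z).2); split.
  by move=> z; exists (enum_val z).1, (enum_val z).2.
move=> D; rewrite Av_sum /Av2 [X in _ / X%:R = _]E natrM invfM mulrA.
rewrite [in RHS](eq_bigr (fun i => (\sum_j (`[< D (a i +++ b j) >])%:R) / N'%:R)); last first.
  by move=> i _; rewrite Av_sum.
rewrite -mulr_suml mulrAC; congr (_ / _ / _).
rewrite pair_bigA /= [RHS](reindex (@enum_val _ {: 'I_N * 'I_N'})) //.
by apply: onW_bij; exact: enum_val_bij.
Qed.

(** By [keisler_gs], for a small model that contains the entries of codes of [mu] and
   [nu]: the concatenations of these entries approximate the tensor product. *)
Lemma tensor_gs (mu : set (I -> M) -> R) (nu : set (J -> M) -> R) :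
  generically_stable K mu -> generically_stable K nu ->
  generically_stable K (tensor K mu nu).
Proof.
move=> muS nuS; have nuK : keisler_measure nu by case: nuS.
have [a aX amu] := gs_code muS; have [b bX bnu] := gs_code nuS.
have [A abA modA] :=
  small_model_containing Kn Kf Kr (small_setU Kn (small_code a) (small_code b)).
apply: (keisler_gs satM Kn _ modA) => [|m phi e e0].
  exact: (tensor_keisler satM Kn Kf Kr muS (gs_approximated muS) nuK).
have [k ke] := prec_small (ler0n R 4) e0.
have [N [c [cP cE]]] := Av2_Av (block a (split_left phi) k) (block b (split_right phi) k).
exists N, c; split=> [z|d].
  have [i [j ->]] := cP z.
  by move=> [x|y]; apply: abA; [left; exists (CodeIndex i x)|right; exists (CodeIndex j y)].
by rewrite cE; apply: le_trans ke; exact: tensor_code_Av2.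
Qed.

End TwoVariables.
End MonsterCodes.

(** * The product of codes *)

Section ProductCode.
Context {R : realType} {K : Type} {L : language} {M : structure L}
  {n : forall (I : finType) m, formula L (I + 'I_m)%type -> R -> nat}.

Lemma code_equiv_refl (I : finType) (a : code_index n I -> M) : code_equiv a a.
Proof.
move=> m phi k b; rewrite subrr normr0 mulr_ge0 //; exact/ltW/prec_gt0.
Qed.

Lemma equiv_measure (I : finType) (a a' : code_index n I -> M) mu :
  code_set a -> code_equiv a a' -> measure_of_code a mu -> measure_of_code a' mu.
Proof.
move=> aX aa' amu m phi b; apply: (@cvg_prec _ _ _ 6) => // k.
have := aa' m phi k b; have := code_approximation phi k aX amu b.
rewrite !ler_norml; lra.
Qed.

Lemma measure_equiv (I : finType) (a a' : code_index n I -> M) mu :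
  code_set a -> code_set a' -> measure_of_code a mu -> measure_of_code a' mu ->
  code_equiv a a'.
Proof.
move=> aX a'X amu a'mu m phi k b.
have := code_approximation phi k aX amu b; have := code_approximation phi k a'X a'mu b.
rewrite !ler_norml; lra.
Qed.

Context {I J : finType}.

(** The constant 6 comes from an error of 2 for each of the three codes. *)
Definition product_code (a : code_index n I -> M) (b : code_index n J -> M)
    (c : code_index n (I + J)%type -> M) : Prop :=
  forall m (phi : formula L (I + J + 'I_m)%type) k d,
    `|Av (block c phi k) (inst phi d) - code_Av2 a b phi k d| <= 6 * prec k.

Hypotheses (satM : saturated K M) (Kn : below K nat)
  (Kf : below K (fun_symbol L)) (Kr : below K (rel_symbol L)).
Hypothesis nP : approximation_numbers K (M := M) n.

Variables (a : code_index n I -> M) (b : code_index n J -> M).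
Variables (mu : set (I -> M) -> R) (nu : set (J -> M) -> R).
Hypotheses (aX : code_set a) (bX : code_set b).
Hypotheses (muS : generically_stable K mu) (nuS : generically_stable K nu).
Hypotheses (amu : measure_of_code a mu) (bnu : measure_of_code b nu).

(** The double averages of [a] and [b] are within [4 / k] of the tensor product, and
   the averages of a code are within [2 / k] of the measure that it represents. *)
Lemma product_codeP c : code_set c ->
  product_code a b c <-> measure_of_code c (tensor K mu nu).
Proof.
move=> cX; have ab m phi k d := @tensor_code_Av2 R K L M n satM Kn Kf Kr nP I J a b mu nu
  m phi k d aX bX amu bnu muS nuS.
split=> [abc m phi d|ctau m phi k d].
  apply: (@cvg_prec _ _ _ 10) => // k.
  by have := ab m phi k d; have := abc m phi k d; rewrite !ler_norml; lra.
have := ab m phi k d; have := code_approximation phi k cX ctau d.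
by rewrite !ler_norml; lra.
Qed.

End ProductCode.

(** * Type-definability of the graph *)

Section DefinableFunctions.
Context {R : realType} {L : language} {M : structure L} {A : set M}.

Definition definable_fun (V : Type) (g : (V -> M) -> R) : Prop :=
  exists (F : finType) (t : (V -> M) -> F) (H : F -> R),
    definable_map A t /\ forall v, g v = H (t v).

Lemma definable_fun2 (V : Type) (op : R -> R -> R) (g h : (V -> M) -> R) :
  definable_fun g -> definable_fun h -> definable_fun (fun v => op (g v) (h v)).
Proof.
move=> [F [t [H [dt gH]]]] [F' [t' [H' [dt' hH']]]].
exists (F * F')%type, (fun v => (t v, t' v)), (fun p => op (H p.1) (H' p.2)).
by split=> [|v]; [exact: definable_map_pair|rewrite gH hH'].
Qed.

Lemma definable_fun_set (V : Type) (Q : R -> Prop) (g : (V -> M) -> R) :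
  definable_fun g -> definable_over A [set v | Q (g v)].
Proof.
move=> [F [t [H [dt gH]]]]; rewrite (_ : [set v | Q (g v)] = [set v | Q (H (t v))]).
  exact: (definable_map_preimage (fun f => Q (H f)) dt).
by apply/seteqP; split=> v /=; rewrite gH.
Qed.

Lemma definable_fun_Av (V I : Type) N (a : (V -> M) -> 'I_N -> I -> M)
    (D : (V -> M) -> set (I -> M)) :
  (forall i, definable_over A [set v | D v (a v i)]) ->
  definable_fun (fun v => Av (a v) (D v)).
Proof.
move=> dD; exists {ffun 'I_N -> bool}, (truth (fun i => [set v | D v (a v i)])).
exists (fun s : {ffun 'I_N -> bool} => #|[pred i | s i]|%:R / N%:R).
split; first exact: definable_map_truth.
by move=> v; rewrite /Av; congr (_%:R / _); apply: eq_card => i; rewrite !inE ffunE.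
Qed.

Lemma definable_fun_sum (V : Type) N (g : 'I_N -> (V -> M) -> R) :
  (forall i, definable_fun (g i)) -> definable_fun (fun v => \sum_i g i v).
Proof.
elim: N g => [|N IHN] g dg.
  exists unit, (fun=> tt), (fun=> 0); split=> [[]|v]; last by rewrite big_ord0.
  exact: (@definable_cst _ _ _ _ (tt = tt)).
have [F [t [H [dt gH]]]] := definable_fun2 +%R (dg ord0) (IHN _ (fun i => dg (lift ord0 i))).
by exists F, t, H; split=> // v; rewrite big_ord_recl gH.
Qed.

Lemma definable_exists_fin (V : Type) (I : finType) (D : set (V + I -> M)) :
  definable_over A D -> definable_over A [set v : V -> M | exists x, D (v +++ x)].
Proof.
move=> dD.
pose h (z : V + I) : V + 'I_#|I| :=
  match z with inl v => inl v | inr x => inr (enum_rank x) end.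
have := definable_exists_tuple (definable_reindex h dD).
congr (definable_over A _); apply/seteqP; split=> v /= [x Dx].
  exists (x \o enum_rank); congr (D _) : Dx.
  by apply: funext => -[].
exists (x \o enum_val); congr (D _) : Dx.
by apply: funext => -[//|y] /=; rewrite enum_rankK.
Qed.

Lemma type_definable_inter (V : Type) (DD : set (set (V -> M))) :
  (forall D, DD D -> definable_over A D) ->
  type_definable A [set v | forall D, DD D -> D v].
Proof.
move=> dDD; exists [set phi : pformula A V | DD [set v | psat phi v]].
apply/seteqP; split=> v /= vD; first by move=> phi /vD.
by move=> D DDD; have [phi E] := dDD D DDD; rewrite E; apply: vD; rewrite /= -E.
Qed.

Lemma type_definable_setI (V : Type) (D D' : set (V -> M)) :
  type_definable A D -> type_definable A D' -> type_definable A (D `&` D').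
Proof.
move=> [S ->] [S' ->]; exists (S `|` S'); apply/seteqP; split=> v /=.
  by move=> [vS vS'] phi [/vS|/vS'].
by move=> H; split=> phi Hphi; apply: H; [left|right].
Qed.

Lemma type_definable_reindex (V W : Type) (h : V -> W) (D : set (V -> M)) :
  type_definable A D -> type_definable A [set w : W -> M | D (w \o h)].
Proof.
move=> [S ->].
have := @type_definable_inter W
  [set E | exists2 phi, S phi & E = [set w : W -> M | psat phi (w \o h)]].
rewrite (_ : [set v | _] =
    [set w : W -> M | [set v | forall phi, S phi -> psat phi v] (w \o h)]).
  apply=> _ [phi _ ->]; apply: (@definable_reindex _ _ _ _ _ h [set v | psat phi v]).
  by exists phi.
apply/seteqP; split=> w /=.
  by move=> H phi Sphi; apply: (H [set w : W -> M | psat phi (w \o h)]); exists phi.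
by move=> H _ [phi Sphi ->]; exact: H.
Qed.

End DefinableFunctions.

Section GraphDefinable.
Context {R : realType} {L : language} {M : structure L}
  {n : forall (I : finType) m, formula L (I + 'I_m)%type -> R -> nat}.

Lemma definable_block (A : set M) (I : finType) (V : Type) m (phi : formula L (I + 'I_m)%type)
    (h : code_index n I -> V) m' (psi : formula L (I + 'I_m')%type) k i :
  definable_over A [set w : V + 'I_m -> M |
    inst phi (w \o inr) (block (w \o inl \o h) psi k i)].
Proof.
have := definable_sat A phi (fun z : I + 'I_m =>
   match z with inl x => inl (h (CodeIndex i x)) | inr j => inr j end : V + 'I_m).
congr (definable_over A _); apply/seteqP; split=> w; rewrite /inst /= => H;
  congr (sat phi _) : H; by apply: funext => -[].
Qed.

(** Each condition on codes is a property of all tuples of parameters, and compares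
   averages, which are determined by finitely many truth values; that two instances
   are inconsistent is expressed by a quantifier over the tuple [x]. *)
Lemma code_set_type_definable (I : finType) :
  type_definable set0 (@code_set R L M n I).
Proof.
pose coherent m (phi : formula L (I + 'I_m)%type) k k1 k2 (a : code_index n I -> M) b :=
  `|Av (block a phi k1) (inst phi b) - Av (block a phi k2) (inst phi b)| <= 2 * prec k :> R.
pose additive m1 m2 (phi1 : formula L (I + 'I_m1)%type) (phi2 : formula L (I + 'I_m2)%type) k
    (a : code_index n I -> M) b1 b2 :=
  `|Av (block a (disj phi1 phi2) k) (inst phi1 b1 `|` inst phi2 b2)
    - (Av (block a phi1 k) (inst phi1 b1) + Av (block a phi2 k) (inst phi2 b2))|
  <= 3 * prec k :> R.
pose cond1 m phi k k1 k2 : set (code_index n I -> M) :=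
  [set a | forall b, @coherent m phi k k1 k2 a b].
pose cond2 m1 m2 phi1 phi2 k : set (code_index n I -> M) :=
  [set a | forall b1 b2, inst phi1 b1 `&` inst phi2 b2 = set0 :> set (I -> M) ->
     @additive m1 m2 phi1 phi2 k a b1 b2].
have := @type_definable_inter L M set0 (code_index n I)
  ([set D | exists m (phi : formula L (I + 'I_m)%type) k k1 k2,
      [/\ (k <= k1)%N, (k <= k2)%N & D = cond1 m phi k k1 k2]] `|`
   [set D | exists m1 m2 phi1 phi2 k, D = cond2 m1 m2 phi1 phi2 k]).
rewrite (_ : [set v | _] = @code_set R L M n I); last first.
  apply/seteqP; split=> a /=.
    move=> H; split=> [m phi k k1 k2 b kk1 kk2|m1 m2 phi1 phi2 k b1 b2].
      by apply: (H (cond1 m phi k k1 k2)); left; exists m, phi, k, k1, k2.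
    by apply: (H (cond2 m1 m2 phi1 phi2 k)); right; exists m1, m2, phi1, phi2, k.
  move=> [a1 a2] D [[m [phi [k [k1 [k2 [kk1 kk2 ->]]]]]]|[m1 [m2 [phi1 [phi2 [k ->]]]]]] /=.
    by move=> b; exact: a1.
  by move=> b1 b2; exact: a2.
apply=> D [[m [phi [k [k1 [k2 [_ _ ->]]]]]]|[m1 [m2 [phi1 [phi2 [k ->]]]]]].
  apply: (@definable_forall_tuple _ _ _ _ _ [set w : code_index n I + 'I_m -> M |
    coherent m phi k k1 k2 (w \o inl) (w \o inr)]).
  apply: (definable_fun_set (fun r : R => `|r| <= 2 * prec k)).
  apply: (definable_fun2 (fun x y => x - y)); apply: definable_fun_Av => i;
    exact: (@definable_block _ _ _ _ _ id).
pose V := (code_index n I + 'I_m1 + 'I_m2)%type.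
pose c1 (w : V -> M) := w \o inl \o inr; pose c2 (w : V -> M) := w \o inr.
pose ca (w : V -> M) := w \o inl \o inl.
have d2 m' (psi : formula L (I + 'I_m')%type) i :
    definable_over set0 [set w : V -> M | inst phi2 (c2 w) (block (ca w) psi k i)].
  exact: (@definable_block _ _ (code_index n I + 'I_m1) _ phi2 inl).
have d1 m' (psi : formula L (I + 'I_m')%type) i :
    definable_over set0 [set w : V -> M | inst phi1 (c1 w) (block (ca w) psi k i)].
  have := @definable_block set0 _ _ _ phi1 id _ psi k i.
  by move=> /(definable_reindex (inl : code_index n I + 'I_m1 -> V)).
apply: (@definable_forall_tuple _ _ _ _ _ [set v : code_index n I + 'I_m1 -> M |
  forall b2, inst phi1 (v \o inr) `&` inst phi2 b2 = set0 :> set (I -> M) ->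
    additive _ _ phi1 phi2 k (v \o inl) (v \o inr) b2]).
apply: (@definable_forall_tuple _ _ _ _ _ [set w : V -> M |
  inst phi1 (c1 w) `&` inst phi2 (c2 w) = set0 :> set (I -> M) ->
    additive _ _ phi1 phi2 k (ca w) (c1 w) (c2 w)]).
rewrite (_ : [set w | _] =
    [set w : V -> M | exists x, inst phi1 (c1 w) x /\ inst phi2 (c2 w) x] `|`
    [set w | additive _ _ phi1 phi2 k (ca w) (c1 w) (c2 w)]); last first.
  apply/seteqP; split=> w /=.
    move=> H; have [ex|nex] := pselect (exists x, inst phi1 (c1 w) x /\ inst phi2 (c2 w) x).
      by left.
    right; apply: H; apply/seteqP; split=> // x [x1 x2]; apply: nex.
    by exists x; split.
  move=> [[x [x1 x2]] E|//].
  by have : (inst phi1 (c1 w) `&` inst phi2 (c2 w)) x by []; rewrite E.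
apply: definable_setU.
  apply: (@definable_exists_fin _ _ _ _ _ [set u : V + I -> M |
    inst phi1 (c1 (u \o inl)) (u \o inr) /\ inst phi2 (c2 (u \o inl)) (u \o inr)]).
  apply: definable_setI.
    have := definable_sat (set0 : set M) phi1 (fun z : I + 'I_m1 =>
      match z with inl x => inr x | inr j => inl (inl (inr j)) end : V + I).
    congr (definable_over _ _); apply/seteqP; split=> u; rewrite /inst /= => H;
      congr (sat phi1 _) : H; by apply: funext => -[].
  have := definable_sat (set0 : set M) phi2 (fun z : I + 'I_m2 =>
    match z with inl x => inr x | inr j => inl (inr j) end : V + I).
  congr (definable_over _ _); apply/seteqP; split=> u; rewrite /inst /= => H;
    congr (sat phi2 _) : H; by apply: funext => -[].
apply: (definable_fun_set (fun r : R => `|r| <= 3 * prec k)).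
apply: (definable_fun2 (fun x y => x - y)).
  by apply: definable_fun_Av => i; apply: definable_setU; [exact: d1|exact: d2].
by apply: (definable_fun2 +%R); apply: definable_fun_Av => i; [exact: d1|exact: d2].
Qed.

Context {I J : finType}.

Lemma product_code_type_definable :
  type_definable set0
    [set v : code_index n I + code_index n J + code_index n (I + J)%type -> M |
     product_code (v \o inl \o inl) (v \o inl \o inr) (v \o inr)].
Proof.
set V := (code_index n I + code_index n J + code_index n (I + J)%type)%type.
pose E m (phi : formula L (I + J + 'I_m)%type) k : set (V -> M) := [set v : V -> M | forall d,
    `|Av (block (v \o inr) phi k) (inst phi d) -
      code_Av2 (v \o inl \o inl) (v \o inl \o inr) phi k d| <= 6 * prec k].
have := @type_definable_inter L M set0 V
  [set D | exists m (phi : formula L (I + J + 'I_m)%type) k, D = E m phi k].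
rewrite (_ : [set v | forall D, _] = [set v : V -> M |
    product_code (v \o inl \o inl) (v \o inl \o inr) (v \o inr)]); last first.
  apply/seteqP; split=> v /=.
    by move=> H m phi k; apply: (H (E m phi k)); exists m, phi, k.
  by move=> H _ [m [phi [k ->]]]; exact: H.
apply=> _ [m [phi [k ->]]].
apply: (@definable_forall_tuple _ _ _ _ _ [set w : V + 'I_m -> M |
  `|Av (block (w \o inl \o inr) phi k) (inst phi (w \o inr)) -
   code_Av2 (w \o inl \o inl \o inl) (w \o inl \o inl \o inr) phi k (w \o inr)| <= 6 * prec k]).
apply: (definable_fun_set (fun r : R => `|r| <= 6 * prec k)).
apply: (definable_fun2 (fun x y => x - y)).
  by apply: definable_fun_Av => i; exact: (@definable_block _ _ _ _ _ inr).
have [|F [t [H [dt tH]]]] := @definable_fun_sum R L M set0 (V + 'I_m) _ (fun i w =>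
   Av (block (w \o inl \o inl \o inr) (split_right phi) k)
      [set y | inst phi (w \o inr)
                 (block (w \o inl \o inl \o inl) (split_left phi) k i +++ y)]).
  move=> i; apply: definable_fun_Av => j.
  have := definable_sat (set0 : set M) phi (fun z : I + J + 'I_m =>
      match z with inl (inl x) => inl (inl (inl (CodeIndex i x)))
      | inl (inr y) => inl (inl (inr (CodeIndex j y))) | inr j => inr j end : V + 'I_m).
  congr (definable_over _ _); apply/seteqP; split=> u; rewrite /inst /= => Hu;
    congr (sat phi _) : Hu; by apply: funext => -[[]|].
exists F, t, (fun f => H f / (n (split_left phi) (prec k))%:R); split=> // w.
by rewrite /code_Av2 /Av2 -tH.
Qed.

End GraphDefinable.

(** * The map on classes of codes *)

Section CodeMap.
Context {R : realType} {K : Type} {L : language} {M : structure L}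
  {n : forall (I : finType) m, formula L (I + 'I_m)%type -> R -> nat} {I J : finType}.
Hypotheses (satM : saturated K M) (Kn : below K nat)
  (Kf : below K (fun_symbol L)) (Kr : below K (rel_symbol L)).
Hypothesis nP : approximation_numbers K (M := M) n.

Lemma product_code_exists (a : code_index n I -> M) (b : code_index n J -> M) :
  code_set a -> code_set b ->
  exists2 c : code_index n (I + J)%type -> M, code_set c & product_code a b c.
Proof.
move=> aX bX.
have [mu muS amu] := code_gs satM Kn Kf Kr nP aX.
have [nu nuS bnu] := code_gs satM Kn Kf Kr nP bX.
have [c cX ctau] := gs_code nP (tensor_gs satM Kn Kf Kr nP muS nuS).
exists c => //.
exact/(product_codeP satM Kn Kf Kr nP aX bX muS nuS amu bnu cX).
Qed.

(** Codes in the same class represent the same measure, and [product_codeP] only refers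
   to the measures. *)
Lemma product_code_equiv (a a' : code_index n I -> M) (b b' : code_index n J -> M)
    (c c' : code_index n (I + J)%type -> M) :
  code_set a -> code_set a' -> code_set b -> code_set b' -> code_set c -> code_set c' ->
  code_equiv a a' -> code_equiv b b' -> product_code a b c ->
  code_equiv c c' <-> product_code a' b' c'.
Proof.
move=> aX a'X bX b'X cX c'X aa' bb' abc.
have [mu muS amu] := code_gs satM Kn Kf Kr nP aX.
have [nu nuS bnu] := code_gs satM Kn Kf Kr nP bX.
have a'mu := equiv_measure aX aa' amu; have b'nu := equiv_measure bX bb' bnu.
have /(product_codeP satM Kn Kf Kr nP aX bX muS nuS amu bnu cX) ctau := abc.
have c'P := product_codeP satM Kn Kf Kr nP a'X b'X muS nuS a'mu b'nu c'X.
split=> [cc'|/c'P c'tau]; last exact: measure_equiv ctau c'tau.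
by apply/c'P; exact: equiv_measure ctau.
Qed.

Definition code_class (V : finType) (a : code_index n V -> M) (aX : code_set a) :
    codes M n V :=
  exist _ (eclass (@code_set R L M n V) (@code_equiv R L M n V) a) (ex_intro2 _ _ a aX erefl).

Lemma code_map_exists : exists f : codes M n I * codes M n J -> codes M n (I + J)%type,
  forall C D, exists a b c, [/\ code_set a, code_set b & code_set c] /\
    [/\ sval C = eclass (@code_set R L M n I) (@code_equiv R L M n I) a,
        sval D = eclass (@code_set R L M n J) (@code_equiv R L M n J) b,
        sval (f (C, D)) = eclass (@code_set R L M n (I + J)%type)
                                 (@code_equiv R L M n (I + J)%type) c &
        product_code a b c].
Proof.
suff /choice[f fP] : forall p : codes M n I * codes M n J, exists q : codes M n (I + J)%type,
    exists a b c, [/\ code_set a, code_set b & code_set c] /\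
    [/\ sval p.1 = eclass (@code_set R L M n I) (@code_equiv R L M n I) a,
        sval p.2 = eclass (@code_set R L M n J) (@code_equiv R L M n J) b,
        sval q = eclass (@code_set R L M n (I + J)%type)
                                 (@code_equiv R L M n (I + J)%type) c &
        product_code a b c].
  by exists f => C D; exact: (fP (C, D)).
move=> [[C [a aX Ca]] [D [b bX Db]]].
have [c cX abc] := product_code_exists aX bX.
by exists (code_class cX), a, b, c.
Qed.

End CodeMap.

Theorem proposition3p28 (R : realType) (L : language) (T : theory L)
    (K : Type) (M : structure L)
    (n : forall (I : finType) (m : nat), formula L (I + 'I_m)%type -> R -> nat)
    (I J : finType) :
  complete_theory T -> NIP T -> monster K T M ->
  approximation_numbers K (M := M) n ->
  exists f : codes M n I * codes M n J -> codes M n (I + J)%type,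
    (forall (mu : set (I -> M) -> R) (nu : set (J -> M) -> R)
            (C : codes M n I) (D : codes M n J),
       generically_stable K mu -> generically_stable K nu ->
       is_code C mu -> is_code D nu ->
       is_code (f (C, D)) (tensor K mu nu)) /\
    map_type_definable set0 f.
Proof.
move=> _ _ [_ Kn' Kf' Kr' satM _] nP.
have below_small U : small K [set: U] -> below K U.
  by move=> /smallE; apply: contra_not => KU; exact: embeds_trans (embeds_setT U).
have [Kn Kf Kr] := And3 (below_small _ Kn') (below_small _ Kf') (below_small _ Kr').
have [f fP] := code_map_exists (I := I) (J := J) satM Kn Kf Kr nP; exists f; split.
  move=> mu nu C D muS nuS [a aX [Ca amu]] [b bX [Db bnu]].
  have [a0 [b0 [c [[a0X b0X cX] [Ca0 Db0 fc abc]]]]] := fP C D.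
  have aa0 : code_equiv a a0.
    have : sval C a0 by rewrite Ca0; split=> //; exact: code_equiv_refl.
    by rewrite Ca => -[].
  have bb0 : code_equiv b b0.
    have : sval D b0 by rewrite Db0; split=> //; exact: code_equiv_refl.
    by rewrite Db => -[].
  exists c => //; split=> //.
  apply/(product_codeP satM Kn Kf Kr nP a0X b0X muS nuS _ _ cX) => //;
    [exact: equiv_measure amu|exact: equiv_measure bnu].
have := type_definable_setI (type_definable_setI
    (type_definable_setI
      (type_definable_reindex (inl \o inl) (code_set_type_definable (n := n) (M := M) I))
      (type_definable_reindex (inl \o inr) (code_set_type_definable (n := n) (M := M) J)))
    (type_definable_reindex inr (code_set_type_definable (n := n) (M := M) (I + J)%type)))
  (product_code_type_definable (n := n) (M := M) (I := I) (J := J)).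
congr (type_definable _ _); apply/seteqP; split=> v.
  move=> [[[aX bX] cX] abc].
  exists (code_class aX), (code_class bX).
  have [a0 [b0 [c0 [[a0X b0X c0X] [Ca0 Db0 fc0 abc0]]]]] := fP (code_class aX) (code_class bX).
  have aa : sval (code_class aX) (v \o inl \o inl) by split=> //; exact: code_equiv_refl.
  have bb : sval (code_class bX) (v \o inl \o inr) by split=> //; exact: code_equiv_refl.
  split=> //; rewrite fc0; split=> //.
  move: aa bb; rewrite Ca0 Db0 => -[_ aa] [_ bb].
  exact/(product_code_equiv satM Kn Kf Kr nP a0X aX b0X bX c0X cX aa bb abc0).
move=> [C [D]]; have [a0 [b0 [c0 [[a0X b0X c0X] [-> -> -> abc0]]]]] := fP C D.
move=> [[aX aa] [bX bb] [cX cc]]; split=> //.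
exact/(product_code_equiv satM Kn Kf Kr nP a0X aX b0X bX c0X cX aa bb abc0).
Qed.
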